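(* Let $n\ge1$, let $d$ be even with $0\le d\le 2n$, and put $g=n-1$ and $2l=2n-d$. The Jones representation $\pi_q^{2n,d}$ of the braid group $B_{2n}$ has a natural extension to $q=-1$ for which it is equivalent to a subrepresentation of $\hat\rho_{\hom}^{g,l}$. That is, the representation of $B_{2n}$ on $V^{2n,d}$ given by $\sigma_i\mapsto A^{-1}\eta_A^{2n,d}(\sigma_i)$ with $A=\exp(-\pi i/4)$ is equivalent to a subrepresentation of the representation $\hat\rho_{\hom}^{g,l}$ of $B_{2n}$ on $\Lambda^lH_1(\Sigma_g^2,\mathbb{C})$.
   Context: $B_m$ is the braid group on $m$ strands with standard generators $\sigma_1,\dots,\sigma_{m-1}$. Diagram representations. For $0\le d\le m$ with $d\equiv m \pmod 2$, let $V^{m,d}$ be the complex vector space with basis the (isotopy classes of) planar non-crossing pairings of $m$ points at the top and $d$ points at the bottom of a rectangle, such that every bottom point is paired with a top point. Let $e_1,\dots,e_{m-1}$ be the standard Temperley--Lieb generators ($e_i$ is the diagram with a cup joining top points $i,i+1$, a cap joining bottom points $i,i+1$, and vertical strands elsewhere). For $A\in\mathbb{C}\setminus\{0\}$, $e_i$ acts on $V^{m,d}$ by stacking it on top of a diagram, removing each closed circle at the cost of a factor $-A^2-A^{-2}$, and setting the result to $0$ if two bottom points become connected. Then $\eta_A^{m,d}:B_m\to GL(V^{m,d})$ is given by $\sigma_i\mapsto A\,\mathrm{id}+A^{-1}e_i$. Jones representation and its extension. For $q\in\mathbb{C}\setminus\{0\}$ that is not an $l$-th root of unity for any $2\le l\le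 m$, $\pi_q^{m,d}$ denotes the Jones representation of $B_m$ (in Wenzl's normalization) attached to the two-row Young diagram $((m+d)/2\ge (m-d)/2)$. For generic $A$ with $A^4=q$ it is equivalent to $\sigma_i\mapsto A^{-1}\eta_A^{m,d}(\sigma_i)=\mathrm{id}+A^{-2}e_i$, and the natural extension of $\pi_q^{m,d}$ to other non-zero $q$ is by this formula; at $q=-1$ one takes $A=\exp(-\pi i/4)$. Homological representation. $\Sigma_g^2$ is the oriented surface of genus $g$ with two boundary components. Let $\gamma_0,\beta_1,\gamma_1,\dots,\beta_g,\gamma_g$ be the standard chain of $2g+1$ simple closed curves on $\Sigma_g^2$: consecutive curves meet transversally in exactly one point, non-consecutive curves are disjoint, and $\Sigma_g^2$ is a regular neighbourhood of their union up to boundary collars (in particular their classes form a basis of $H_1(\Sigma_g^2,\mathbb{C})$). With $g=n-1$, $\hat\rho_{\hom}^{g,l}$ is the action of $B_{2n}$ on $\Lambda^lH_1(\Sigma_g^2,\mathbb{C})$ in which $\sigma_1,\dots,\sigma_{2n-1}$ act by the maps induced on the $l$-th exterior power by the homological actions of the right Dehn twists $t_{\gamma_0},t_{\beta_1},t_{\gamma_1},\dots,t_{\beta_g},t_{\gamma_g}$ respectively. Convention: $\Lambda^0H_1=\mathbb{C}$. *)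

(* Defs.v *)
From HB Require Import structures.
From mathcomp Require Import all_boot all_order all_algebra.
From mathcomp Require Import all_classical all_reals all_analysis.
From mathcomp Require Export complex.

Set Implicit Arguments.
Unset Strict Implicit.
Unset Printing Implicit Defensive.

Import Order.TTheory GRing.Theory Num.Theory.
Import numFieldNormedType.Exports.

Local Open Scope classical_set_scope.
Local Open Scope ring_scope.
Local Open Scope complex_scope.

(** * Braid groups, by generators and relations *)

(* The letter (i, true) stands for sigma_i and (i, false) for its inverse; the
   index i : 'I_m.-1 is 0-based. *)
Definition braid_word (m : nat) := seq ('I_m.-1 * bool).

Inductive braid_eq (m : nat) : braid_word m -> braid_word m -> Prop :=
| braid_eq_refl w : braid_eq w w
| braid_eq_sym w1 w2 : braid_eq w1 w2 -> braid_eq w2 w1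
| braid_eq_trans w1 w2 w3 :
    braid_eq w1 w2 -> braid_eq w2 w3 -> braid_eq w1 w3
| braid_eq_cat u1 u2 v1 v2 :
    braid_eq u1 u2 -> braid_eq v1 v2 -> braid_eq (u1 ++ v1) (u2 ++ v2)
| braid_eq_cancel i b : braid_eq [:: (i, b); (i, ~~ b)] [::]
| braid_eq_far (i j : 'I_m.-1) : (i.+1 < j)%N ->
    braid_eq [:: (i, true); (j, true)] [:: (j, true); (i, true)]
| braid_eq_braid (i j : 'I_m.-1) : j = i.+1 :> nat ->
    braid_eq [:: (i, true); (j, true); (i, true)]
             [:: (j, true); (i, true); (j, true)].

Section BraidGroup.
Variable m : nat.
Implicit Types u v w : braid_word m.

Definition braid_eqb : rel (braid_word m) := fun u v => `[< braid_eq u v >].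

Lemma braid_eqb_refl : reflexive braid_eqb.
Proof. by move=> w; apply/asboolP; exact: braid_eq_refl. Qed.

Lemma braid_eqb_sym : symmetric braid_eqb.
Proof. by move=> u v; apply/asboolP/asboolP; exact: braid_eq_sym. Qed.

Lemma braid_eqb_trans : transitive braid_eqb.
Proof.
by move=> v u w /asboolP uv /asboolP vw; apply/asboolP; exact: braid_eq_trans vw.
Qed.

Canonical braid_equiv :=
  EquivRel braid_eqb braid_eqb_refl braid_eqb_sym braid_eqb_trans.

Definition braid_group := {eq_quot braid_equiv}%qT.

HB.instance Definition _ := Choice.on braid_group.
HB.instance Definition _ := EqQuotient.on braid_group.

Definition braid_of (w : braid_word m) : braid_group := (\pi_braid_group w)%qT.

Definition braid_inv_word w : braid_word m :=
  rev [seq (p.1, ~~ p.2) | p <- w].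

Definition braid_one := braid_of [::].
Definition braid_mul (x y : braid_group) := braid_of (repr x ++ repr y).
Definition braid_inv (x : braid_group) := braid_of (braid_inv_word (repr x)).

Lemma braid_ofP u v : braid_of u = braid_of v <-> braid_eq u v.
Proof.
by split=> [/eqmodP/asboolP//|uv]; apply/eqmodP/asboolP.
Qed.

Lemma braid_ofK x : braid_of (repr x) = x.
Proof. exact: reprK. Qed.

Lemma repr_braid_of w : braid_eq (repr (braid_of w)) w.
Proof. by apply/braid_ofP; rewrite braid_ofK. Qed.

Lemma braid_mulE u v : braid_mul (braid_of u) (braid_of v) = braid_of (u ++ v).
Proof. by apply/braid_ofP/braid_eq_cat; exact: repr_braid_of. Qed.

Lemma braid_eq_catV w : braid_eq (w ++ braid_inv_word w) [::].
Proof.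
elim: w => [|[i b] w IHw]; first exact: braid_eq_refl.
rewrite /braid_inv_word /= rev_cons -cats1 catA -cat1s.
apply: braid_eq_trans (braid_eq_cancel i b).
rewrite -[[:: (i, b); _]]cat1s; apply: braid_eq_cat; first exact: braid_eq_refl.
rewrite -[X in braid_eq _ X]cat0s.
by apply: braid_eq_cat IHw _; exact: braid_eq_refl.
Qed.

Lemma braid_inv_wordK w : braid_inv_word (braid_inv_word w) = w.
Proof.
rewrite /braid_inv_word map_rev revK -map_comp -[RHS]map_id.
by apply: eq_map => -[i b] /=; rewrite negbK.
Qed.

Lemma braid_mulA : associative braid_mul.
Proof.
move=> x y z; rewrite -(braid_ofK x) -(braid_ofK y) -(braid_ofK z).
by rewrite !braid_mulE catA.
Qed.

Lemma braid_mul1 : left_id braid_one braid_mul.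
Proof. by move=> x; rewrite -(braid_ofK x) /braid_one braid_mulE. Qed.

Lemma braid_mulr1 : right_id braid_one braid_mul.
Proof. by move=> x; rewrite -(braid_ofK x) /braid_one braid_mulE cats0. Qed.

Lemma braid_mulV : left_inverse braid_one braid_inv braid_mul.
Proof.
move=> x; rewrite -[x in X in braid_mul _ X]braid_ofK braid_mulE.
by apply/braid_ofP; rewrite -{2}[repr x]braid_inv_wordK; exact: braid_eq_catV.
Qed.

Lemma braid_mulrV : right_inverse braid_one braid_inv braid_mul.
Proof.
move=> x; rewrite -[x in X in braid_mul X _]braid_ofK braid_mulE.
by apply/braid_ofP; exact: braid_eq_catV.
Qed.

HB.instance Definition _ := isGroup.Build braid_group
  braid_mulA braid_mul1 braid_mulr1 braid_mulV braid_mulrV.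

Definition sigma (i : 'I_m.-1) : braid_group := braid_of [:: (i, true)].

End BraidGroup.

(** * Matrix representations *)

(* Matrices act on column vectors, so that a product of braids acts as the
   composite of the corresponding endomorphisms. *)
Definition is_rep (G : groupType) (F : fieldType) k (rho : G -> 'M[F]_k) :=
  rho 1%g = 1%:M /\ forall x y, rho (x * y)%g = rho x *m rho y.

Definition equiv_to_subrep (G : groupType) (F : fieldType) k1 k2
    (eta : G -> 'M[F]_k1) (rho : G -> 'M[F]_k2) :=
  exists W : {vspace 'cV[F]_k2},
    (forall x w, w \in W -> rho x *m w \in W) /\
    exists f : {linear 'cV[F]_k1 -> 'cV[F]_k2},
      [/\ injective f,
          (forall w, w \in W <-> exists v, w = f v)
        & forall x v, f (eta x *m v) = rho x *m f v].

(** * Temperley-Lieb diagrams *)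

(* inl i is the i-th point of the top edge, inr j the j-th point of the bottom
   edge, both counted from the left. *)
Definition bdpoint (m k : nat) := ('I_m + 'I_k)%type.

Definition is_pairing m k (p : {ffun bdpoint m k -> bdpoint m k}) :=
  [forall x, (p (p x) == x) && (p x != x)].

(* Rank of a point when the boundary of the rectangle is traversed clockwise
   from the top left corner. *)
Definition bdrank m k (x : bdpoint m k) : nat :=
  match x with inl i => i | inr j => m + (k - j.+1) end.

Definition noncrossing m k (p : {ffun bdpoint m k -> bdpoint m k}) :=
  [forall x, forall y,
     ~~ [&& bdrank x < bdrank y, bdrank y < bdrank (p x)
          & bdrank (p x) < bdrank (p y)]%N].

Definition is_top m k (x : bdpoint m k) := if x is inl _ then true else false.

Definition basis_diagram m d (p : {ffun bdpoint m d -> bdpoint m d}) :=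
  [&& is_pairing p, noncrossing p & [forall j : 'I_d, is_top (p (inr j))]].

(* The basis of V^{m,d}. *)
Definition diagram (m d : nat) :=
  {p : {ffun bdpoint m d -> bdpoint m d} | basis_diagram p}.

Lemma ltn_ord_pred m (i : 'I_m.-1) : (i < m)%N.
Proof. by case: m i => [|m] [i lti] //=; exact: ltnW. Qed.

Lemma ltn_ordS_pred m (i : 'I_m.-1) : (i.+1 < m)%N.
Proof. by case: m i => [|m] [i lti]. Qed.

Definition ordL m (i : 'I_m.-1) : 'I_m := Ordinal (ltn_ord_pred i).
Definition ordR m (i : 'I_m.-1) : 'I_m := Ordinal (ltn_ordS_pred i).

Definition tl_gen m (i : 'I_m.-1) : {ffun bdpoint m m -> bdpoint m m} :=
  [ffun x => match x with
   | inl a => if a == ordL i then inl (ordR i)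
              else if a == ordR i then inl (ordL i) else inr a
   | inr a => if a == ordL i then inr (ordR i)
              else if a == ordR i then inr (ordL i) else inl a
   end].

Section Stacking.
Variables (m k d : nat) (D : {ffun bdpoint m k -> bdpoint m k})
  (E : {ffun bdpoint k d -> bdpoint k d}).

(* D is placed on top of E; the bottom points of D are identified with the top
   points of E. *)
Definition stack_point := ('I_m + 'I_k + 'I_d)%type.

Definition upper_point (x : bdpoint m k) : stack_point := inl x.

Definition lower_point (x : bdpoint k d) : stack_point :=
  match x with inl a => inl (inr a) | inr b => inr b end.

Definition outer_point (x : bdpoint m d) : stack_point :=
  match x with inl a => inl (inl a) | inr b => inr b end.

Definition is_middle (u : stack_point) :=
  if u is inl (inr _) then true else false.

Definition stack_edge : rel stack_point := fun u v =>
  [exists x, (u == upper_point x) && (v == upper_point (D x))] ||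
  [exists x, (u == lower_point x) && (v == lower_point (E x))].

Definition stack_loops : nat :=
  n_comp stack_edge
    [pred u | [forall v, connect stack_edge u v ==> is_middle v]].

(* P is the pairing left by the stacked diagram once its closed circles are
   removed. *)
Definition is_stack (P : {ffun bdpoint m d -> bdpoint m d}) :=
  [forall x, forall y, (x != y) ==>
     ((P x == y) == connect stack_edge (outer_point x) (outer_point y))].

End Stacking.

Section DiagramRepresentation.
Variables (F : fieldType) (A : F) (m d : nat).

(* The matrix of e_i on V^{m,d}. If stacking e_i on a basis diagram connects
   two bottom points, then no basis diagram satisfies is_stack and the
   corresponding column is zero, as required. *)
Definition tl_mx (i : 'I_m.-1) : 'M[F]_#|{: diagram m d}| :=
  \matrix_(r, c)
    (let E := val (enum_val c : diagram m d) in
     let P := val (enum_val r : diagram m d) in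
     if is_stack (tl_gen i) E P
     then (- A ^+ 2 - A ^- 2) ^+ stack_loops (tl_gen i) E else 0).

Definition eta_gen (i : 'I_m.-1) : 'M[F]_#|{: diagram m d}| :=
  A%:M + A^-1 *: tl_mx i.

End DiagramRepresentation.

Definition expi (R : realType) (theta : R) : R[i] := cos theta +i* sin theta.

(** * Singular homology with complex coefficients *)

Section SingularHomology.
Variable R : realType.

Definition std_simplex (k : nat) : set 'rV[R]_k.+1 :=
  [set x | (forall i, 0 <= x ord0 i) /\ \sum_i x ord0 i = 1].
Arguments std_simplex : clear implicits.

Definition face_row k (i : 'I_k.+2) (x : 'rV[R]_k.+1) : 'rV[R]_k.+2 :=
  \row_j (if unlift i j is Some j' then x ord0 j' else 0).

Lemma face_row_simplex k (i : 'I_k.+2) (x : std_simplex k) :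
  face_row i (set_val x) \in std_simplex k.+1.
Proof.
have [x0 x1] := set_valP x; apply/mem_set; split=> [j|].
  by rewrite mxE; case: unliftP => [j' _|_]; rewrite ?x0.
rewrite (bigD1_ord i) //= mxE unlift_none add0r -x1.
by apply: eq_bigr => j _; rewrite mxE liftK.
Qed.

Definition face k (i : 'I_k.+2) (x : std_simplex k) : std_simplex k.+1 :=
  SigSub (face_row_simplex i x).

Variable S : topologicalType.

(* A k-chain is given by its coefficient function on maps from the standard
   k-simplex to S. *)
Definition chain k := (std_simplex k -> S) -> R[i].

Definition is_chain k (c : chain k) :=
  finite_set [set s | c s != 0] /\ forall s, c s != 0 -> continuous s.

Definition simplex_chain k (s : std_simplex k -> S) : chain k :=
  fun u => (`[< u = s >])%:R.

Definition boundary k (c : chain k.+1) : chain k := fun u =>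
  \sum_(s \in [set: std_simplex k.+1 -> S])
    c s * \sum_(i < k.+2) (-1) ^+ i * simplex_chain (s \o face i) u.

Definition is_cycle k (z : chain k.+1) :=
  is_chain z /\ forall u, boundary z u = 0.

Definition homologous k (z w : chain k) :=
  exists c : chain k.+1, is_chain c /\ forall u, z u - w u = boundary c u.

Definition lincomb_chain k N (x : 'cV[R[i]]_N) (s : 'I_N -> std_simplex k -> S) :
    chain k :=
  fun u => \sum_j x j ord0 * simplex_chain (s j) u.

(* s is a family of loops whose classes form a basis of H_1(S; C). *)
Definition H1_basis N (s : 'I_N -> std_simplex 1 -> S) :=
  (forall j, is_cycle (simplex_chain (s j))) /\
  forall z, is_cycle z ->
    exists! x : 'cV[R[i]]_N, homologous z (lincomb_chain x s).

(* M is the matrix, with respect to the basis of H_1(S; C) formed by the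
   classes of s, of the endomorphism induced by f. *)
Definition H1_matrix N (s : 'I_N -> std_simplex 1 -> S) (f : S -> S)
    (M : 'M[R[i]]_N) :=
  forall j, homologous (simplex_chain (f \o s j)) (lincomb_chain (col j M) s).

End SingularHomology.
Arguments std_simplex : clear implicits.

(** * Chains of curves and Dehn twists *)

Section Surface.
Variables (R : realType) (S : topologicalType).

(* Annuli are parametrized by R x [0, 1], with period 1 in the first
   coordinate and oriented by dx /\ dt. *)
Definition strip : set (R * R) := [set p | 0 <= p.2 <= 1].

Definition annulus (a : R * R -> S) :=
  [/\ {within strip, continuous a},
      (forall (x t : R), 0 <= t <= 1 -> a (x + 1, t) = a (x, t))
    & forall (x t x' t' : R), 0 <= t <= 1 -> 0 <= t' <= 1 ->
        a (x, t) = a (x', t') -> t = t' /\ exists p : int, x = x' + p%:~R].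

Definition core (a : R * R -> S) : std_simplex R 1 -> S :=
  fun u => a (set_val u ord0 ord_max, 2^-1).

(* The two annuli meet exactly in one square, which is [0, 1/4] x [0, 1] in the
   coordinates of a and [1/2, 3/4] x [0, 1] in those of b; the coordinate change
   (x, t) |-> (1/2 + t/4, 1 - 4x) is orientation-preserving and exchanges the two
   directions, so the cores cross once, transversally. *)
Definition plumbed (a b : R * R -> S) :=
  forall (x t y s : R), 0 <= t <= 1 -> 0 <= s <= 1 ->
    a (x, t) = b (y, s) <->
    (exists p : int, x = (1 - s) / 4 + p%:~R) /\
    (exists q : int, y = 2^-1 + t / 4 + q%:~R).

Definition disjoint_annuli (a b : R * R -> S) :=
  forall (x t y s : R), 0 <= t <= 1 -> 0 <= s <= 1 -> a (x, t) <> b (y, s).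

(* S is a regular neighbourhood of the chain of curves core (a 0), ...,
   core (a (N - 1)), with the orientation of the annuli. These conditions
   determine S up to homeomorphism; for N = 2g + 1 it is the surface of genus g
   with two boundary components. The last condition is the standard fact that
   the curves of the chain give a basis of H_1. *)
Record curve_chain N (a : 'I_N -> R * R -> S) : Prop := CurveChain {
  cc_hausdorff : hausdorff_space S;
  cc_annulus : forall k, annulus (a k);
  cc_cover : forall p : S, exists k (x t : R), 0 <= t <= 1 /\ p = a k (x, t);
  cc_consecutive : forall i j : 'I_N, j = i.+1 :> nat -> plumbed (a i) (a j);
  cc_far : forall i j : 'I_N, (i.+1 < j)%N -> disjoint_annuli (a i) (a j);
  cc_basis : H1_basis (fun k => core (a k))
}.

(* Going across the annulus in either direction, (x, t) |-> (x + t, t) turns to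
   the right with respect to the orientation dx /\ dt. *)
Definition right_Dehn_twist (a : R * R -> S) (f : S -> S) :=
  [/\ continuous f,
      (forall (x t : R), 0 <= t <= 1 -> f (a (x, t)) = a (x + t, t))
    & forall p, (forall (x t : R), 0 <= t <= 1 -> p <> a (x, t)) -> f p = p].

End Surface.

(** * Exterior powers *)

Section ExteriorPower.
Variables (F : fieldType) (N l : nat).

(* An increasing sequence I indexes the basis vector e_(I 0) /\ e_(I 1) /\ ...
   of the l-th exterior power of F^N. *)
Definition incr_seq :=
  {I : {ffun 'I_l -> 'I_N} | [forall r : 'I_l, forall s : 'I_l, (r < s)%N ==> (I r < I s)%N]}.

Definition wedge (v : 'I_l -> 'cV[F]_N) : 'cV[F]_#|{: incr_seq}| :=
  \col_I \det (\matrix_(r, c) v c (val (enum_val I : incr_seq) r) ord0).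

(* P is the map induced by M on the l-th exterior power. *)
Definition is_ext_power (M : 'M[F]_N) (P : 'M[F]_#|{: incr_seq}|) :=
  forall v : 'I_l -> 'cV[F]_N, P *m wedge v = wedge (fun c => M *m v c).

End ExteriorPower.

(* Main.v *)
(* Write m = 2n and let io be the imaginary unit. At A = exp(-pi i/4) a closed
   circle is worth 0 and sigma_i acts on V^{m,d} by 1 + io e_i. Let e_i act on
   the spin chain (C^2)^{(x) m} by - io w w^T on the factors i, i+1, where
   w = |10> + io |01>; sending a diagram to the product of one vector w per cup
   and one |0> per through strand intertwines the two actions of e_i, because
   the two ends of a strand are straightened by w up to the factor io.
   The weight-l part of the spin chain is the l-th exterior power of C^m, with
   no signs for operators supported on two adjacent factors, and there 1 + io e_i
   is the exterior power of the matrix 1 + w w^T. The vectors w_i = x_i + io x_(i+1)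
   span the kernel H of one linear form psi, and on a suitable multiple c_i of w_i the
   matrices 1 + w w^T act as the Dehn twists along the chain act on H_1.
   Contraction with psi kills the image of every diagram, since the two ends of
   a cup contribute opposite terms; hence the images lie in the l-th exterior
   power of H, that is of H_1. They are independent because among the ways of
   choosing one end per chord the choice of all last ends is extremal and
   determines a noncrossing pairing. In particular the braid relations on
   V^{m,d} are inherited from those of the Dehn twists. *)

Require Import Defs.
From mathcomp Require Import all_boot all_order all_fingroup all_algebra.
From mathcomp Require Import ring lra zify.

Set Implicit Arguments.
Unset Strict Implicit.
Unset Printing Implicit Defensive.

Import Order.TTheory GRing.Theory Num.Theory.

Local Open Scope ring_scope.

(** * Exterior powers of matrices *)

Section ExteriorMatrix.
Variable F : fieldType.

(** The [l]-th compound matrix: it represents the exterior power of [M] in the basis indexed by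
    [incr_seq] that [wedge] uses. *)
Definition ext_mx l m n (M : 'M[F]_(m, n)) :
    'M[F]_(#|{: incr_seq m l}|, #|{: incr_seq n l}|) :=
  \matrix_(I < #|{: incr_seq m l}|, J < #|{: incr_seq n l}|)
    \det (mxsub (val (enum_val I : incr_seq m l)) (val (enum_val J : incr_seq n l)) M).

Lemma incr_seqP n l (I : incr_seq n l) : {mono val I : r s / (r < s)%N}.
Proof.
move=> r s; have /forallP H := valP I.
have mono (r' s' : 'I_l) : (r' < s')%N -> (val I r' < val I s')%N.
  by move: (H r') => /forallP/(_ s')/implyP.
apply/idP/idP; last exact: mono.
by apply: contraTT; rewrite -!leqNgt leq_eqVlt => /orP[/eqP/val_inj -> // | /mono/ltnW].
Qed.

Lemma incr_seq_inj n l (I : incr_seq n l) : injective (val I).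
Proof.
move=> r s e.
have rs := incr_seqP I r s.
have sr := incr_seqP I s r.
move: rs sr; rewrite e ltnn => /esym/negbT; rewrite -leqNgt => sr /esym/negbT.
rewrite -leqNgt => rs; apply/val_inj/eqP.
by rewrite eqn_leq rs.
Qed.

Lemma sorted_enum_ord n : sorted (relpre val ltn) (enum 'I_n).
Proof. by rewrite -sorted_map val_enum_ord iota_ltn_sorted. Qed.

(** One inclusion of images suffices because both have [l] elements; a strictly sorted list is then
    determined by its set of values. *)
Lemma incr_seq_ext n l (I J : incr_seq n l) :
  (forall r, exists s, val I r = val J s) -> I = J.
Proof.
move=> IJ; have sK (K : incr_seq n l) : sorted (relpre val ltn) (map (val K) (enum 'I_l)).
  by apply: homo_sorted (sorted_enum_ord l) => r s /=; rewrite (incr_seqP K).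
have uK (K : incr_seq n l) : uniq (map (val K) (enum 'I_l)).
  by rewrite map_inj_uniq ?enum_uniq //; exact: incr_seq_inj.
have eIJ : map (val I) (enum 'I_l) = map (val J) (enum 'I_l).
  apply: (irr_sorted_eq (leT := relpre val ltn)) => //.
  - by move=> x y z /=; exact: ltn_trans.
  - by move=> x /=; rewrite ltnn.
  suff sIJ : {subset map (val I) (enum 'I_l) <= map (val J) (enum 'I_l)}.
    by have [] := uniq_min_size (uK I) sIJ; rewrite ?size_map.
  by move=> x /mapP[r _ ->]; have [s ->] := IJ r; rewrite map_f // mem_enum.
apply/val_inj/ffunP => r.
by have /eq_in_map := eIJ; apply; rewrite mem_enum.
Qed.

Lemma incr_seq_of_inj n l (f : 'I_l -> 'I_n) : injective f ->
  exists (I : incr_seq n l) (s : 'S_l), forall r, f r = val I (s r).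
Proof.
move=> injf; pose A := [set f r | r : 'I_l].
have cA : #|A| = l by rewrite card_imset // card_ord.
have fA r : f r \in A by apply: imset_f.
pose I := [ffun r => enum_val (cast_ord (esym cA) r)].
have incrI : [forall r : 'I_l, forall s : 'I_l, (r < s)%N ==> (I r < I s)%N].
  apply/forallP => r; apply/forallP => s; apply/implyP => rs; rewrite !ffunE.
  rewrite !(enum_val_nth (f r)).
  apply: (@sorted_ltn_nth _ (relpre val ltn)) => //=.
  - by move=> x y z /=; exact: ltn_trans.
  - rewrite /enum_mem; apply: sorted_filter; first by move=> x y z /=; exact: ltn_trans.
    by have := sorted_enum_ord n; rewrite enumT.
  - by rewrite inE -cardE cA.
  - by rewrite inE -cardE cA.
pose s r := cast_ord cA (enum_rank_in (fA r) (f r)).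
have fs r : f r = I (s r) by rewrite ffunE cast_ordK enum_rankK_in.
have injs : injective s by move=> r r' e; apply: injf; rewrite !fs e.
by exists (exist _ I incrI), (perm injs) => r; rewrite permE.
Qed.

Lemma det_mulmx_ffun l n (A : 'M[F]_(l, n)) (B : 'M[F]_(n, l)) :
  \det (A *m B) = \sum_(f : {ffun 'I_l -> 'I_n})
     (\prod_r A r (f r)) * \det (rowsub f B).
Proof.
rewrite /determinant.
under eq_bigr => s _ do (under eq_bigr => r _ do rewrite mxE;
  rewrite bigA_distr_bigA /= mulr_sumr).
rewrite exchange_big /=; apply: eq_bigr => f _; rewrite mulr_sumr.
apply: eq_bigr => s _; rewrite mulrCA -big_split /=; congr (_ * _).
by apply: eq_bigr => r _; rewrite !mxE.
Qed.

(** By multilinearity the determinant is a sum over all maps [f]. A repeated value gives two equal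
    rows; an injective [f] is uniquely a permutation followed by an increasing sequence, and summing
    over the permutations rebuilds the minor of [A]. *)
Lemma cauchy_binet l n (A : 'M[F]_(l, n)) (B : 'M[F]_(n, l)) :
  \det (A *m B) = \sum_(I : incr_seq n l)
     \det (colsub (val I) A) * \det (rowsub (val I) B).
Proof.
pose G (f : {ffun 'I_l -> 'I_n}) := (\prod_r A r (f r)) * \det (rowsub f B).
pose h (p : incr_seq n l * 'S_l) := [ffun r => val p.1 (p.2 r)].
have injh : injective h.
  move=> [I s] [J t] /ffunP e.
  have {}e r : val I (s r) = val J (t r) by have := e r; rewrite !ffunE.
  have IJ : I = J.
    by apply: incr_seq_ext => r; exists (t (s^-1%g r)); rewrite -e permKV.
  subst J; congr (_, _); apply/permP => r; exact: (@incr_seq_inj _ _ I).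
have G0 f : f \notin h @: setT -> G f = 0.
  move=> fh; have /injectivePn[r [r' rr' e]] : ~~ injectiveb f.
    apply: contra fh => /injectiveP/incr_seq_of_inj[I [s fIs]].
    by apply/imsetP; exists (I, s) => //; apply/ffunP => r; rewrite ffunE.
  by rewrite /G (determinant_alternate rr') ?mulr0 // => k; rewrite !mxE e.
rewrite det_mulmx_ffun (bigID (mem (h @: setT))) /= [X in _ + X]big1 // addr0.
rewrite big_imset; last by move=> p q _ _; exact: injh.
rewrite (eq_bigl xpredT) => [|p]; last by rewrite inE.
rewrite -(pair_bigA _ (fun I s => G (h (I, s)))) /=; apply: eq_bigr => I _.
rewrite {2}/determinant mulr_suml; apply: eq_bigr => s _.
have -> : G (h (I, s)) = (\prod_r A r (val I (s r))) *
    \det (row_perm s (rowsub (val I) B)).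
  rewrite /G; congr (_ * _); first by apply: eq_bigr => r _; rewrite ffunE.
  congr determinant.
  by apply/matrixP => r k; rewrite !mxE ffunE.
rewrite row_permE det_mulmx det_perm mulrA; congr (_ * _).
by rewrite mulrC; congr (_ * _); apply: eq_bigr => r _; rewrite mxE.
Qed.

Lemma sum_incr_seq n l (G : incr_seq n l -> F) :
  \sum_I G I = \sum_(k < #|{: incr_seq n l}|) G (enum_val k).
Proof. by rewrite -(big_enum_val (A := {: incr_seq n l})). Qed.

Lemma ext_mxM l m n p (M : 'M[F]_(m, n)) (P : 'M[F]_(n, p)) :
  ext_mx l (M *m P) = ext_mx l M *m ext_mx l P.
Proof.
apply/matrixP => I J; rewrite !mxE.
set f := val (enum_val I); set g := val (enum_val J).
have -> : mxsub f g (M *m P) = rowsub f M *m colsub g P.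
  by apply/matrixP => r s; rewrite !mxE; apply: eq_bigr => k _; rewrite !mxE.
rewrite cauchy_binet sum_incr_seq.
apply: eq_bigr => k _; rewrite !mxE; congr (_ * _); congr determinant;
  by apply/matrixP => r s; rewrite !mxE.
Qed.

Lemma ext_mx1 l n : ext_mx l (1%:M : 'M[F]_n) = 1%:M.
Proof.
apply/matrixP => I J; rewrite !mxE; have [<-|nIJ] := eqVneq I J.
  rewrite -[RHS](det1 F l); congr determinant; apply/matrixP => r s; rewrite !mxE.
  by rewrite (inj_eq (@incr_seq_inj _ _ _)).
(* Some value of the first sequence is missed by the second, and its row in the minor is zero. *)
have /existsP[r /forallP nr] :
    [exists r, [forall s, val (enum_val I) r != val (enum_val J) s]].
  apply: contra_neqT nIJ; rewrite negb_exists => /forallP h; apply: enum_val_inj.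
  apply: incr_seq_ext => r; have := h r; rewrite negb_forall.
  by move=> /existsP[s /negPn/eqP ->]; exists s.
rewrite (expand_det_row _ r) big1 // => s _.
by rewrite !mxE (negPf (nr s)) mul0r.
Qed.

(** The coordinates of a wedge are the maximal minors of the matrix with columns [v c], so
    Cauchy-Binet applies once more. *)
Lemma ext_mx_is_ext_power l n (M : 'M[F]_n) : is_ext_power M (ext_mx l M).
Proof.
move=> v; apply/matrixP => I z; rewrite !mxE.
set f := val (enum_val I).
have -> : (\matrix_(r, c) (M *m v c) (f r) ord0) =
    rowsub f M *m (\matrix_(k, c) v c k ord0).
  by apply/matrixP => r s; rewrite !mxE; apply: eq_bigr => k _; rewrite !mxE.
rewrite cauchy_binet sum_incr_seq.
apply: eq_bigr => k _; rewrite !mxE; congr (_ * _); congr determinant;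
  by apply/matrixP => r s; rewrite !mxE.
Qed.

End ExteriorMatrix.

(** * Matrices of braid words and of Dehn twists *)

Section BraidWords.
Variables (F : fieldType) (m k : nat) (X : 'I_m.-1 -> 'M[F]_k).

Definition braid_word_mx (w : braid_word m) : 'M[F]_k :=
  foldr (fun p M => (if p.2 then X p.1 else invmx (X p.1)) *m M) 1%:M w.

(** Evaluation on a chosen word; by [braid_word_mx_eq] the choice is immaterial once the [X i] are
    invertible and satisfy the braid relations. *)
Definition braid_rep_of (x : braid_group m) : 'M[F]_k := braid_word_mx (generic_quotient.repr x).

Lemma braid_word_mx_cat u v :
  braid_word_mx (u ++ v) = braid_word_mx u *m braid_word_mx v.
Proof. by elim: u => [|p u IHu] /=; rewrite ?mul1mx // IHu mulmxA. Qed.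

Hypothesis unitX : forall i, X i \in unitmx.
Hypothesis farX : forall i j : 'I_m.-1, (i.+1 < j)%N -> X i *m X j = X j *m X i.
Hypothesis braidX : forall i j : 'I_m.-1, j = i.+1 :> nat ->
  X i *m X j *m X i = X j *m X i *m X j.

Lemma braid_word_mx_eq u v : braid_eq u v -> braid_word_mx u = braid_word_mx v.
Proof.
elim=> {u v} // [u v w _ -> _ -> //|u1 u2 v1 v2 _ IHu _ IHv|i b|i j ij|i j ij].
- by rewrite !braid_word_mx_cat IHu IHv.
- by case: b; rewrite /= mulmx1 ?mulmxV ?mulVmx.
- by rewrite /= !mulmx1 farX.
- by rewrite /= !mulmx1 !mulmxA braidX.
Qed.

Lemma braid_rep_ofE w : braid_rep_of (braid_of w) = braid_word_mx w.
Proof. exact/braid_word_mx_eq/repr_braid_of. Qed.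

Lemma braid_rep_of_sigma i : braid_rep_of (sigma i) = X i.
Proof. by rewrite braid_rep_ofE /= mulmx1. Qed.

Lemma braid_rep_of_is_rep : is_rep braid_rep_of.
Proof.
split; first by rewrite [LHS]braid_rep_ofE.
by move=> x y; rewrite [LHS]braid_rep_ofE braid_word_mx_cat.
Qed.

End BraidWords.

Section Intertwining.
Variables (F : fieldType) (m k k' : nat).
Variables (X : 'I_m.-1 -> 'M[F]_k) (Y : 'I_m.-1 -> 'M[F]_k') (C : 'M[F]_(k', k)).
Hypothesis unitX : forall i, X i \in unitmx.
Hypothesis unitY : forall i, Y i \in unitmx.
Hypothesis CX : forall i, C *m X i = Y i *m C.

Lemma intertwine_word w : C *m braid_word_mx X w = braid_word_mx Y w *m C.
Proof.
elim: w => [|[i b] w IHw]; rewrite /= ?mulmx1 ?mul1mx // -mulmxA -IHw !mulmxA.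
congr (_ *m _); case: b => //=; rewrite -[LHS]mul1mx -(mulVmx (unitY i)).
by rewrite -!mulmxA (mulmxA (Y i)) -CX -mulmxA mulmxV // mulmx1.
Qed.

End Intertwining.

(** * Transvections and the homological matrices of the Dehn twists *)

Section Transvections.
Variables (F : fieldType) (N : nat).
Implicit Types (a b : 'M[F]_N).

Lemma transvection_unit a : a *m a = 0 -> (1%:M + a) *m (1%:M - a) = 1%:M.
Proof.
by move=> aa; rewrite mulmxDl !mulmxBr !mulmx1 !mul1mx aa subr0 subrK.
Qed.

Lemma transvection_comm a b : a *m b = 0 -> b *m a = 0 ->
  (1%:M + a) *m (1%:M + b) = (1%:M + b) *m (1%:M + a).
Proof.
move=> ab ba; rewrite !mulmxDl !mulmxDr !mulmx1 !mul1mx ab ba !addr0.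
by rewrite -!addrA (addrC a).
Qed.

Lemma transvection_braid a b : a *m a = 0 -> b *m b = 0 ->
  a *m b *m a = - a -> b *m a *m b = - b ->
  (1%:M + a) *m (1%:M + b) *m (1%:M + a) = (1%:M + b) *m (1%:M + a) *m (1%:M + b).
Proof.
(* The triple product becomes symmetric in [x] and [y], because [x *m y *m x] cancels one of the two
   copies of [x]. *)
suff H (x y : 'M[F]_N) : x *m x = 0 -> x *m y *m x = - x ->
    (1%:M + x) *m (1%:M + y) *m (1%:M + x) = 1%:M + x + y + (x *m y + y *m x).
  move=> aa bb aba bab; rewrite !H //.
  by rewrite (addrAC _ a b) [X in _ + X = _]addrC.
move=> xx xyx; rewrite !(mulmxDl, mulmxDr, mul1mx, mulmx1) xx xyx.
apply/matrixP => i j; rewrite !mxE; ring.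
Qed.

Definition twist_dir (j : nat) : 'cV[F]_N := \col_k (k == j :> nat)%:R.
(** Picard-Lefschetz coefficients along the chain: the twist about curve [j] adds class [j] to class
    [j+1] and subtracts it from class [j-1]. The test [k.+1 == j] avoids the truncated predecessor
    at [j = 0]. *)
Definition twist_form (j : nat) : 'rV[F]_N :=
  \row_k ((k == j.+1 :> nat)%:R - (k.+1 == j)%:R).
Definition twist_mx (j : nat) : 'M[F]_N := 1%:M + twist_dir j *m twist_form j.

Lemma twist_form_dir i j : (j < N)%N ->
  twist_form i *m twist_dir j = ((j == i.+1)%:R - (j.+1 == i)%:R)%:M.
Proof.
move=> ltj; apply/matrixP => r s; rewrite !ord1 !mxE eqxx mulr1n.
rewrite (bigD1 (Ordinal ltj)) //= !mxE eqxx mulr1 big1 ?addr0 // => k kj.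
by rewrite !mxE -[j]/(val (Ordinal ltj)) val_eqE (negPf kj) mulr0.
Qed.

Lemma twist_prod i j : (j < N)%N ->
  (twist_dir i *m twist_form i) *m (twist_dir j *m twist_form j) =
  ((j == i.+1)%:R - (j.+1 == i)%:R) *: (twist_dir i *m twist_form j).
Proof.
move=> ltj; rewrite mulmxA -(mulmxA _ _ (twist_dir j)) twist_form_dir //.
by rewrite mul_mx_scalar -scalemxAl.
Qed.

Lemma twist_square i : (i < N)%N ->
  (twist_dir i *m twist_form i) *m (twist_dir i *m twist_form i) = 0.
Proof.
move=> lti; rewrite twist_prod //.
have [-> ->] : (i == i.+1) = false /\ (i.+1 == i) = false by lia.
by rewrite subr0 scale0r.
Qed.

Lemma twist_mx_far i j : (j < N)%N -> (i.+1 < j)%N ->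
  twist_mx i *m twist_mx j = twist_mx j *m twist_mx i.
Proof.
move=> ltj ij; have lti : (i < N)%N by lia.
apply: transvection_comm; rewrite twist_prod //.
- have [-> ->] : (j == i.+1) = false /\ (j.+1 == i) = false by lia.
  by rewrite subr0 scale0r.
- have [-> ->] : (i == j.+1) = false /\ (i.+1 == j) = false by lia.
  by rewrite subr0 scale0r.
Qed.

Lemma twist_mx_braid i : (i.+1 < N)%N ->
  twist_mx i *m twist_mx i.+1 *m twist_mx i =
  twist_mx i.+1 *m twist_mx i *m twist_mx i.+1.
Proof.
move=> lti; have lti' := ltnW lti.
have e1 : (i == i.+2) = false by lia.
have e2 : (i.+2 == i) = false by lia.
apply: transvection_braid; rewrite ?twist_square //.
  rewrite twist_prod // eqxx e2 subr0 scale1r mulmxA -(mulmxA _ _ (twist_dir i)).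
  by rewrite twist_form_dir // eqxx e1 sub0r mul_mx_scalar -scalemxAl scaleN1r.
rewrite twist_prod // eqxx e1 sub0r -scalemxAl mulmxA -(mulmxA _ _ (twist_dir i.+1)).
by rewrite twist_form_dir // eqxx e2 subr0 mulmx1 scaleN1r.
Qed.

Lemma ext_twist_unit l i : (i < N)%N -> ext_mx l (twist_mx i) \in unitmx.
Proof.
move=> lti; have [] := @mulmx1_unit _ _ (ext_mx l (twist_mx i))
   (ext_mx l (1%:M - twist_dir i *m twist_form i)) _ => //.
by rewrite -ext_mxM transvection_unit ?ext_mx1 ?twist_square.
Qed.

End Transvections.

(** * Pairings and their surgery *)

Section Pairings.
Variables (m d : nat).
Implicit Types (x y z : bdpoint m d) (p : {ffun bdpoint m d -> bdpoint m d}).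

Lemma bdrank_inj : injective (@bdrank m d).
Proof.
move=> [i|i] [j|j] /=; have := ltn_ord i; have := ltn_ord j => lj li e.
- by congr inl; exact/val_inj.
- lia.
- lia.
- by congr inr; apply/val_inj => /=; lia.
Qed.

Lemma bdrank_eq x y : (bdrank x == bdrank y) = (x == y).
Proof. exact: (inj_eq bdrank_inj). Qed.

Lemma pairingK p : is_pairing p -> involutive p.
Proof. by move=> /forallP h x; have /andP[/eqP] := h x. Qed.

Lemma pairing_neq p x : is_pairing p -> p x != x.
Proof. by move=> /forallP h; have /andP[] := h x. Qed.

Lemma ltn_adjl (a b : nat) : a != b -> a.+1 != b -> (a < b)%N = (a.+1 < b)%N.
Proof. by lia. Qed.

Lemma ltn_adjr (a b : nat) : b != a -> (b < a)%N = (b < a.+1)%N.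
Proof. by lia. Qed.

(** The exclusive or says that a number lies between [x] and [x']. The eight negated hypotheses are
    the interleavings of the two pairs, one for each labelling of the ends and each choice of the
    pair that starts. *)
Lemma separates_nat (x x' y y' : nat) :
  y != x -> y != x' -> y' != x -> y' != x' ->
  ~~ [&& x < y, y < x' & x' < y']%N -> ~~ [&& x < y', y' < x' & x' < y]%N ->
  ~~ [&& x' < y, y < x & x < y']%N -> ~~ [&& x' < y', y' < x & x < y]%N ->
  ~~ [&& y < x, x < y' & y' < x']%N -> ~~ [&& y < x', x' < y' & y' < x]%N ->
  ~~ [&& y' < x, x < y & y < x']%N -> ~~ [&& y' < x', x' < y & y < x]%N ->
  (x < y)%N (+) (x' < y)%N = (x < y')%N (+) (x' < y')%N.
Proof.
by case: (ltngtP x y); case: (ltngtP x' y); case: (ltngtP x y'); case: (ltngtP x' y').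
Qed.

Lemma separates_nat_sym (x x' y y' : nat) :
  y != x -> y != x' -> y' != x -> y' != x' ->
  (y < x)%N (+) (y' < x)%N = (y < x')%N (+) (y' < x')%N ->
  (x < y)%N (+) (x' < y)%N = (x < y')%N (+) (x' < y')%N.
Proof.
by case: (ltngtP x y); case: (ltngtP x' y); case: (ltngtP x y'); case: (ltngtP x' y').
Qed.

Definition separates p x y := (bdrank x < bdrank y)%N (+) (bdrank (p x) < bdrank y)%N.

(** This form does not depend on which end of a chord comes first, which saves case distinctions in
    the surgery arguments. *)
Lemma noncrossingP p : is_pairing p ->
  reflect (forall x y, y != x -> y != p x -> separates p x y = separates p x (p y))
          (noncrossing p).
Proof.
move=> pp; have pK := pairingK pp; apply: (iffP idP) => [/forallP nc x y yx ypx|sep].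
  have ncE z w : ~~ [&& bdrank z < bdrank w, bdrank w < bdrank (p z)
      & bdrank (p z) < bdrank (p w)]%N by have /forallP := nc z; apply.
  have pyx : p y != x by apply: contra ypx => /eqP <-; rewrite pK.
  have pypx : p y != p x by rewrite (inj_eq (inv_inj pK)).
  have := ncE x y; have := ncE x (p y); have := ncE (p x) y.
  have := ncE (p x) (p y); have := ncE y x; have := ncE y (p x).
  have := ncE (p y) x; have := ncE (p y) (p x); rewrite !pK => *.
  by apply: separates_nat; rewrite ?bdrank_eq.
apply/forallP => x; apply/forallP => y; apply/negP => /and3P[h1 h2 h3].
have := sep x y; rewrite /separates -!bdrank_eq h1 h3 (ltn_trans h1 (ltn_trans h2 h3)).
rewrite [(bdrank (p x) < bdrank y)%N]ltnNge (ltnW h2) /=.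
by move=> h; have := h (negbT (gtn_eqF h1)) (negbT (ltn_eqF h2)).
Qed.

(** The result of stacking a Temperley-Lieb generator at neighbours [u], [v] with [p u != v]: its
    two arcs join [u] to [v] and the former partners to each other. *)
Definition surgery p (u v : bdpoint m d) : {ffun bdpoint m d -> bdpoint m d} :=
  [ffun x => if x == u then v else if x == v then u
             else if x == p u then p v else if x == p v then p u else p x].

Section Surgery.
Variables (p : {ffun bdpoint m d -> bdpoint m d}) (u v : bdpoint m d).
Hypotheses (pp : is_pairing p) (nc : noncrossing p).
Hypotheses (uv : bdrank v = (bdrank u).+1) (puv : p u != v).

Let pK : involutive p := pairingK pp.

Lemma surgery_distinct :
  [/\ u != v, p u != u, p v != v & [/\ p v != u, p u != p v & p u != v]].
Proof.
split; rewrite ?pairing_neq //; first by rewrite -bdrank_eq uv; lia.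
split=> //; first by apply: contra puv => /eqP <-; rewrite pK.
by rewrite (inj_eq (inv_inj pK)) -bdrank_eq uv; lia.
Qed.

Lemma surgeryE :
  [/\ surgery p u v u = v, surgery p u v v = u, surgery p u v (p u) = p v,
      surgery p u v (p v) = p u
    & forall x, x != u -> x != v -> x != p u -> x != p v -> surgery p u v x = p x].
Proof.
have [uv' pu pv [pvu pupv _]] := surgery_distinct.
split; rewrite ?ffunE ?eqxx //.
- by rewrite eq_sym (negPf uv').
- by rewrite (negPf pu) (negPf puv).
- by rewrite (negPf pvu) (negPf pv) eq_sym (negPf pupv).
by move=> x /negPf xu /negPf xv /negPf xpu /negPf xpv; rewrite ffunE xu xv xpu xpv.
Qed.

Lemma surgery_cases x :
  [\/ x = u, x = v, x = p u | x = p v \/ [/\ x != u, x != v, x != p u & x != p v]].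
Proof.
have [->|xu] := eqVneq x u; first by constructor 1.
have [->|xv] := eqVneq x v; first by constructor 2.
have [->|xpu] := eqVneq x (p u); first by constructor 3.
constructor 4.
by have [->|xpv] := eqVneq x (p v); [left | right].
Qed.

Lemma other_pairing x : x != u -> x != v -> x != p u -> x != p v ->
  [/\ p x != u, p x != v, p x != p u & p x != p v].
Proof.
move=> xu xv xpu xpv; rewrite !(inj_eq (inv_inj pK)); split=> //.
  by apply: contra xpu => /eqP <-; rewrite pK.
by apply: contra xpv => /eqP <-; rewrite pK.
Qed.

Lemma surgery_pairing : is_pairing (surgery p u v).
Proof.
have [uv' pu pv [pvu pupv _]] := surgery_distinct.
have [e1 e2 e3 e4 e5] := surgeryE.
apply/forallP => x; have [->|->|->|[->|[xu xv xpu xpv]]] := surgery_cases x.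
- by rewrite e1 e2 eqxx eq_sym.
- by rewrite e2 e1 eqxx.
- by rewrite e3 e4 eqxx eq_sym.
- by rewrite e4 e3 eqxx.
have [] := other_pairing xu xv xpu xpv => *.
by rewrite (e5 x) // e5 // pK eqxx pairing_neq.
Qed.

(** The chord joining the neighbours [u] and [v] separates nothing. An untouched chord has [u] and
    [v] on one side, hence also their partners, so it does not separate the other new chord. The
    remaining cases follow by symmetry of linking. *)
Lemma surgery_noncrossing : noncrossing (surgery p u v).
Proof.
have sp := surgery_pairing; apply/(noncrossingP sp).
have sK := pairingK sp.
have [uv' pu pv [pvu pupv _]] := surgery_distinct.
have [e1 e2 e3 e4 e5] := surgeryE.
set q := surgery p u v in sp sK e1 e2 e3 e4 e5 *.
have sep_sym x y : y != x -> y != q x -> separates q y x = separates q y (q x) ->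
    separates q x y = separates q x (q y).
  move=> yx yqx.
  have qyx : q y != x by apply: contra yqx => /eqP <-; rewrite sK.
  have qyqx : q y != q x by rewrite (inj_eq (inv_inj sK)).
  by apply: separates_nat_sym; rewrite ?bdrank_eq.
have sep_u x y : x = u \/ x = v -> y != x -> y != q x ->
    separates q x y = separates q x (q y).
  move=> xuv yx yqx.
  have qyx : q y != x by apply: contra yqx => /eqP <-; rewrite sK.
  have qyqx : q y != q x by rewrite (inj_eq (inv_inj sK)).
  have adj z : z != u -> z != v -> (bdrank u < bdrank z)%N = (bdrank v < bdrank z)%N.
    by move=> zu zv; rewrite uv; apply: ltn_adjl; rewrite -?uv bdrank_eq eq_sym.
  rewrite /separates; case: xuv yx yqx qyx qyqx => ->; rewrite ?e1 ?e2 => yx yqx qyx qyqx.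
    by rewrite !adj // !addbb.
  by rewrite !adj // !addbb.
have sep_p x y : x != u -> x != v -> x != p u -> x != p v ->
    y != x -> y != q x -> separates q x y = separates q x (q y).
  move=> xu xv xpu xpv yx; have qx := e5 x xu xv xpu xpv.
  have sepE z : separates q x z = separates p x z by rewrite /separates qx.
  have [pxu pxv pxpu pxpv] := other_pairing xu xv xpu xpv.
  rewrite !sepE qx => ypx.
  have sepu : separates p x u = separates p x v.
    by rewrite /separates uv; congr (_ (+) _); apply: ltn_adjr; rewrite bdrank_eq.
  have sepp z : z != x -> z != p x -> separates p x z = separates p x (p z).
    by move=> *; have /(noncrossingP pp) := nc; apply.
  have sepuu : separates p x u = separates p x (p u) by apply: sepp; rewrite eq_sym.
  have sepvv : separates p x v = separates p x (p v) by apply: sepp; rewrite eq_sym.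
  have [yu|yv|ypu|[ypv|[yu yv ypu ypv]]] := surgery_cases y.
  - by rewrite yu e1.
  - by rewrite yv e2.
  - by rewrite ypu e3 -sepuu -sepvv.
  - by rewrite ypv e4 -sepuu -sepvv.
  - by rewrite e5 //; exact: sepp.
move=> x y yx yqx.
have xy : x != y by rewrite eq_sym.
have xqy : x != q y by apply: contra yqx => /eqP ->; rewrite sK.
suff H : x = p u \/ x = p v -> separates q x y = separates q x (q y).
  have [xu|xv|xpu|[xpv|[xu xv xpu xpv]]] := surgery_cases x.
  - by apply: sep_u => //; left.
  - by apply: sep_u => //; right.
  - by apply: H; left.
  - by apply: H; right.
  - exact: sep_p.
move=> xpuv; have [ypu ypv] : y != p u /\ y != p v.
  by case: xpuv yx yqx => ->; rewrite ?e3 ?e4.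
apply: sep_sym => //.
have [yu|yu] := eqVneq y u; first by apply: sep_u => //; left.
have [yv|yv] := eqVneq y v; first by apply: sep_u => //; right.
exact: sep_p.
Qed.

End Surgery.
End Pairings.

(** * Spin weights *)

Section Weights.
Variables (F : fieldType) (io : F) (m d : nat).
Hypothesis io2 : io * io = -1.
Implicit Types (x y z : bdpoint m d) (p : {ffun bdpoint m d -> bdpoint m d}).
Implicit Types (chi : bdpoint m d -> bool).

(* A chord contributes 1 if chi singles out its first end, io if chi singles
   out its last end, and 0 otherwise: these are the coordinates of the vector
   w = |10> + io |01>, whose isotropy makes closed circles worth 0. Bottom
   points will always be singled out, so that a through strand gives |0>. *)
Definition end_weight p chi x : F :=
  if chi x == chi (p x) then 0
  else if chi x && (bdrank (p x) < bdrank x)%N then io else 1.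

Definition weight p chi : F := \prod_x end_weight p chi x.

Definition other4 (u v a b : bdpoint m d) x := [&& x != u, x != v, x != a & x != b].

Lemma prod_other4 u v a b (f : bdpoint m d -> F) :
  u != v -> a != u -> a != v -> b != u -> b != v -> b != a ->
  \prod_x f x = (f u * f a) * (f v * f b) * \prod_(x | other4 u v a b x) f x.
Proof.
move=> uv au av bu bv ba.
have vu : v != u by rewrite eq_sym.
rewrite (bigD1 u) //= (bigD1 v) /= ?vu // (bigD1 a) /= ?au ?av //.
rewrite (bigD1 b) /= ?bu ?bv ?ba //.
rewrite (eq_bigl (other4 u v a b)) => [|x]; last by rewrite /other4 -!andbA.
ring.
Qed.

(** The contribution of one chord: [s] and [t] are the values of [chi] at its ends, and [c] tells
    that the end carrying [s] is the last one. *)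
Let g (s t c : bool) : F :=
  (if s == t then 0 else if s && c then io else 1) *
  (if t == s then 0 else if t && ~~ c then io else 1).

Section WeightSurgery.
Variables (p : {ffun bdpoint m d -> bdpoint m d}) (u v : bdpoint m d).
Hypotheses (pp : is_pairing p) (nc : noncrossing p).
Hypothesis uv : bdrank v = (bdrank u).+1.
Variables (chi chi' : bdpoint m d -> bool).
Hypothesis chi_u : chi u.
Hypothesis chi_v : ~~ chi v.
Hypothesis chi_u' : ~~ chi' u.
Hypothesis chi_v' : chi' v.
Hypothesis chi_other : forall x, x != u -> x != v -> chi' x = chi x.

Let pK : involutive p := pairingK pp.

Lemma weight_adjacent : p u = v -> weight p chi' = io * weight p chi.
Proof.
move=> pu; have pv : p v = u by rewrite -pu pK.
have vu : v != u by rewrite -bdrank_eq uv gtn_eqF.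
rewrite /weight (bigD1 u) //= (bigD1 v) //=.
rewrite [in RHS](bigD1 u) //= [in RHS](bigD1 v) //=.
rewrite /end_weight pu pv chi_v' (negPf chi_u') chi_u (negPf chi_v) uv leqnn /=.
rewrite ltnNge leqnSn /= !mul1r; congr (_ * _).
apply: eq_bigr => x /andP[xu xv].
have pxu : p x != u by apply: contra xv => /eqP e; rewrite -pu -e pK.
have pxv : p x != v by apply: contra xu => /eqP e; rewrite -pv -e pK.
by rewrite !chi_other.
Qed.

(** This is [- io w w^T] on two adjacent factors: pairing with [w] gives
    [weight p chi + io * weight p chi'], and the new cup, with coordinates [1] and [io], is scaled
    by [- io]. The other chords keep their weights, so a finite check on the two chords at [u] and
    [v] remains. *)
Lemma weight_surgery : p u != v ->
  [/\ weight (surgery p u v) chi = - io * (weight p chi + io * weight p chi'),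
      weight (surgery p u v) chi' = weight p chi + io * weight p chi'
    & forall ch, ch u = ch v -> weight (surgery p u v) ch = 0].
Proof.
move=> puv; have [uv' pu pv [pvu pupv _]] := surgery_distinct pp nc uv puv.
have [e1 e2 e3 e4 e5] := surgeryE pp nc uv puv.
have pvpu : p v != p u by rewrite eq_sym.
set q := surgery p u v in e1 e2 e3 e4 e5 *.
pose A := (bdrank (p u) < bdrank u)%N; pose B := (bdrank (p v) < bdrank v)%N.
pose C := (bdrank (p u) < bdrank (p v))%N.
have nA : (bdrank u < bdrank (p u))%N = ~~ A.
  by rewrite /A -leqNgt [RHS]leq_eqVlt bdrank_eq eq_sym (negPf pu).
have nB : (bdrank v < bdrank (p v))%N = ~~ B.
  by rewrite /B -leqNgt [RHS]leq_eqVlt bdrank_eq eq_sym (negPf pv).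
have nC : (bdrank (p v) < bdrank (p u))%N = ~~ C.
  by rewrite /C -leqNgt [RHS]leq_eqVlt bdrank_eq (negPf pvpu).
(* Noncrossing leaves three positions for the partners: both to the right or both to the left, with
   [p v] before [p u], or [p u] to the left and [p v] to the right. *)
have ABC : [|| [&& ~~ A, ~~ B & ~~ C], [&& A, B & ~~ C] | [&& A, ~~ B & C]].
  have := (noncrossingP pp nc) u v; rewrite !(eq_sym v) => /(_ uv' puv).
  have Bu : (bdrank (p v) < bdrank u)%N = B.
    by rewrite /B uv; apply: ltn_adjr; rewrite bdrank_eq.
  have Au : (bdrank (p u) < bdrank v)%N = A.
    by rewrite /A uv; apply/esym/ltn_adjr; rewrite bdrank_eq.
  have uB : (bdrank u < bdrank (p v))%N = ~~ B.
    by rewrite -nB uv; apply: ltn_adjl; rewrite -?uv bdrank_eq eq_sym.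
  rewrite /separates Au uB uv leqnn -/C.
  have : A || ~~ B || ~~ C.
    apply/negPn; rewrite !negb_or !negbK -nA -Bu; apply/negP => /andP[/andP[h1 h2]].
    by rewrite /C ltnNge (ltnW (ltn_trans h2 h1)).
  by case: (A); case: (B); case: (C).
have wE (r : {ffun bdpoint m d -> bdpoint m d}) (ch : bdpoint m d -> bool) :
    weight r ch = (end_weight r ch u * end_weight r ch (p u)) *
      (end_weight r ch v * end_weight r ch (p v)) *
      \prod_(x | other4 u v (p u) (p v) x) end_weight r ch x.
  exact: prod_other4.
have vu_rank : (bdrank v < bdrank u)%N = false by rewrite uv; clear; lia.
have uv_rank : (bdrank u < bdrank v)%N by rewrite uv.
have restq ch : \prod_(x | other4 u v (p u) (p v) x) end_weight q ch x =
    \prod_(x | other4 u v (p u) (p v) x) end_weight p ch x.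
  by apply: eq_bigr => x /and4P[? ? ? ?]; rewrite /end_weight e5.
have rest' : \prod_(x | other4 u v (p u) (p v) x) end_weight p chi' x =
    \prod_(x | other4 u v (p u) (p v) x) end_weight p chi x.
  apply: eq_bigr => x /and4P[xu xv xpu xpv].
  have [h1 h2 h3 h4] := other_pairing pp xu xv xpu xpv.
  by rewrite /end_weight !chi_other.
set rest := \prod_(x | _) end_weight p chi x in rest' restq.
have qE ch : (end_weight q ch u * end_weight q ch (p u)) *
    (end_weight q ch v * end_weight q ch (p v)) =
    g (ch u) (ch v) false * g (ch (p u)) (ch (p v)) (~~ C).
  rewrite /end_weight e1 e2 e3 e4 vu_rank uv_rank nC /g negbK -/C andbF andbT.
  by rewrite mulrACA.
have pE ch : (end_weight p ch u * end_weight p ch (p u)) *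
    (end_weight p ch v * end_weight p ch (p v)) =
    g (ch u) (ch (p u)) A * g (ch v) (ch (p v)) B.
  by rewrite /end_weight !pK nA nB.
have cu : chi' (p u) = chi (p u) by rewrite chi_other.
have cv : chi' (p v) = chi (p v) by rewrite chi_other.
split; last 1 first.
- move=> ch chuv; rewrite wE qE /g chuv eqxx !mul0r //.
- rewrite !wE qE !pE restq ?rest' -/rest cu cv (negPf chi_u') chi_v' chi_u (negPf chi_v).
  suff -> : g true false false * g (chi (p u)) (chi (p v)) (~~ C) =
      - io * (g true (chi (p u)) A * g false (chi (p v)) B +
              io * (g false (chi (p u)) A * g true (chi (p v)) B)) by ring.
  move: ABC; case: (A); case: (B); case: (C) => //= _;
  case: (chi (p u)); case: (chi (p v)); rewrite /g /= ?mul0r ?mulr0 ?mul1r ?mulr1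
    ?add0r ?addr0 ?mulrA ?mulr0 ?mulr1 ?io2 ?mulNr ?mulrN ?mul1r ?io2 ?opprK ?mul1r
    ?oppr0 ?mulN1r ?opprK //.
- rewrite !wE qE !pE restq ?rest' -/rest cu cv (negPf chi_u') chi_v' chi_u (negPf chi_v).
  suff -> : g false true false * g (chi (p u)) (chi (p v)) (~~ C) =
      g true (chi (p u)) A * g false (chi (p v)) B +
              io * (g false (chi (p u)) A * g true (chi (p v)) B) by ring.
  move: ABC; case: (A); case: (B); case: (C) => //= _;
  case: (chi (p u)); case: (chi (p v)); rewrite /g /= ?mul0r ?mulr0 ?mul1r ?mulr1
    ?add0r ?addr0 ?mulrA ?mulr0 ?mulr1 ?io2 ?mulNr ?mulrN ?mul1r ?io2 ?opprK ?mul1r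
    ?oppr0 ?mulN1r ?opprK //.
Qed.

End WeightSurgery.
End Weights.

(** * Stacking a Temperley-Lieb generator *)

Section StackTL.
Variables (m d : nat) (i : 'I_m.-1) (E : {ffun bdpoint m d -> bdpoint m d}).
Hypotheses (pE : is_pairing E) (ncE : noncrossing E).

Let u : bdpoint m d := inl (ordL i).
Let v : bdpoint m d := inl (ordR i).
Let D := tl_gen i.
Let e := stack_edge D E.

Lemma bdrank_ordR : bdrank v = (bdrank u).+1.
Proof. by []. Qed.

Lemma ordL_neq_ordR : ordL i != ordR i.
Proof. by rewrite -val_eqE /= ltn_eqF. Qed.

Let LR := ordL_neq_ordR.
Let RL : ordR i == ordL i = false.
Proof. by rewrite eq_sym (negPf LR). Qed.

Lemma tl_gen_inlL : D (inl (ordL i)) = inl (ordR i).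
Proof. by rewrite ffunE eqxx. Qed.
Lemma tl_gen_inlR : D (inl (ordR i)) = inl (ordL i).
Proof. by rewrite ffunE RL eqxx. Qed.
Lemma tl_gen_inrL : D (inr (ordL i)) = inr (ordR i).
Proof. by rewrite ffunE eqxx. Qed.
Lemma tl_gen_inrR : D (inr (ordR i)) = inr (ordL i).
Proof. by rewrite ffunE RL eqxx. Qed.
Lemma tl_gen_inl a : a != ordL i -> a != ordR i -> D (inl a) = inr a.
Proof. by rewrite ffunE => /negPf -> /negPf ->. Qed.
Lemma tl_gen_inr a : a != ordL i -> a != ordR i -> D (inr a) = inl a.
Proof. by rewrite ffunE => /negPf -> /negPf ->. Qed.

Lemma tl_genK : involutive D.
Proof.
move=> [] a; (have [->|aL] := eqVneq a (ordL i);
    first by rewrite ?tl_gen_inlL ?tl_gen_inrL ?tl_gen_inlR ?tl_gen_inrR);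
  (have [->|aR] := eqVneq a (ordR i);
    first by rewrite ?tl_gen_inlR ?tl_gen_inrR ?tl_gen_inlL ?tl_gen_inrL).
all: by do 2!rewrite ?(tl_gen_inl aL aR) ?(tl_gen_inr aL aR).
Qed.

Lemma stack_edgeP s t :
  reflect ((exists2 x, s = upper_point d x & t = upper_point d (D x)) \/
           (exists2 x, s = lower_point m x & t = lower_point m (E x))) (e s t).
Proof.
apply: (iffP orP) => -[].
- by move=> /existsP[x /andP[/eqP -> /eqP ->]]; left; exists x.
- by move=> /existsP[x /andP[/eqP -> /eqP ->]]; right; exists x.
- by move=> [x -> ->]; left; apply/existsP; exists x; rewrite !eqxx.
- by move=> [x -> ->]; right; apply/existsP; exists x; rewrite !eqxx.
Qed.

Lemma stack_edge_upper x : e (upper_point d x) (upper_point d (D x)).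
Proof. by apply/stack_edgeP; left; exists x. Qed.

Lemma stack_edge_lower x : e (lower_point m x) (lower_point m (E x)).
Proof. by apply/stack_edgeP; right; exists x. Qed.

Lemma stack_connect_sym : connect_sym e.
Proof.
apply: sym_connect_sym => s t; apply/stack_edgeP/stack_edgeP => -[] [x -> ->].
- by left; exists (D x) => //; rewrite tl_genK.
- by right; exists (E x) => //; rewrite (pairingK pE).
- by left; exists (D x) => //; rewrite tl_genK.
- by right; exists (E x) => //; rewrite (pairingK pE).
Qed.

(** The middle points at positions [i] and [i+1] are joined both by the generator and by [E], so
    they form a component without outer points. *)
Lemma stack_loops_gt0 : E u = v -> (0 < stack_loops D E)%N.
Proof.
move=> Eu; have Ev : E v = u by rewrite -Eu (pairingK pE).
pose L : stack_point m m d := inl (inr (ordL i)).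
pose R : stack_point m m d := inl (inr (ordR i)).
have step s t : s = L \/ s = R -> e s t -> t = L \/ t = R.
  move=> sLR /stack_edgeP[[x sx ->]|[x sx ->]]; case: sLR => es.
  - have -> : x = inr (ordL i) by move: sx; rewrite es => -[].
    by rewrite tl_gen_inrL; right.
  - have -> : x = inr (ordR i) by move: sx; rewrite es => -[].
    by rewrite tl_gen_inrR; left.
  - have -> : x = u by case: x sx => [a|b]; rewrite es => // -[<-].
    by rewrite Eu; right.
  - have -> : x = v by case: x sx => [a|b]; rewrite es => // -[<-].
    by rewrite Ev; left.
have connL s : connect e L s -> s = L \/ s = R.
  have last_path p s' : s' = L \/ s' = R -> path e s' p ->
      last s' p = L \/ last s' p = R.
    elim: p s' => [|t p IHp] s' //= sLR /andP[st]; apply: IHp; exact: step st.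
  by move=> /connectP[p pth ->]; apply: last_path pth; left.
rewrite lt0n /stack_loops /n_comp_mem -lt0n; apply/card_gt0P; exists (fingraph.root e L).
rewrite !inE roots_root ?[_ (root _ _)]/=; last exact: stack_connect_sym.
apply/forallP => s; apply/implyP => rs; have := connect_trans (connect_root e L) rs.
by move=> /connL[] ->.
Qed.

Hypothesis Euv : E u != v.
Let E' := surgery E u v.

(** Retraction of the stacked diagram onto its outer points: the two middle points at the generator
    follow their chords of [E], the others rise along vertical strands. *)
Let r (s : stack_point m m d) : bdpoint m d :=
  match s with
  | inl (inl t) => inl t
  | inl (inr t) => if t == ordL i then E u else if t == ordR i then E v else inl t
  | inr j => inr j
  end.

Let r_lower x : x != u -> x != v -> r (lower_point m x) = x.
Proof.
case: x => //= a; rewrite !(inj_eq (@inl_inj _ _)) => /negPf -> /negPf -> //.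
Qed.

Lemma stack_edge_surgery s t : e s t -> r t = r s \/ r t = E' (r s).
Proof.
have [uv' Eu Ev [Evu EuEv _]] := surgery_distinct pE ncE bdrank_ordR Euv.
have [e1 e2 e3 e4 e5] := surgeryE pE ncE bdrank_ordR Euv.
move=> /stack_edgeP[] [x -> ->].
  case: x => a.
  - have [->|aL] := eqVneq a (ordL i); first by right; rewrite tl_gen_inlL [RHS]e1.
    have [->|aR] := eqVneq a (ordR i); first by right; rewrite tl_gen_inlR [RHS]e2.
    by left; rewrite tl_gen_inl //= (negPf aL) (negPf aR).
  - have [->|aL] := eqVneq a (ordL i).
      by right; rewrite tl_gen_inrL /= eqxx RL eqxx [RHS]e3.
    have [->|aR] := eqVneq a (ordR i).
      by right; rewrite tl_gen_inrR /= eqxx RL eqxx [RHS]e4.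
    by left; rewrite tl_gen_inr //= (negPf aL) (negPf aR).
have rL : r (lower_point m u) = E u by rewrite /= eqxx.
have rR : r (lower_point m v) = E v by rewrite /= eqxx RL.
have [xu|xv|xu|[xv|[xu xv xEu xEv]]] := surgery_cases E u v x; rewrite ?xu ?xv.
- by left; rewrite rL r_lower.
- by left; rewrite rR r_lower.
- by left; rewrite (pairingK pE) rL r_lower.
- by left; rewrite (pairingK pE) rR r_lower.
have [Exu Exv _ _] := other_pairing pE xu xv xEu xEv.
by right; rewrite !r_lower // e5.
Qed.

(** Each edge is collapsed by [r] or sent to a chord of [E']; since [E'] is an involution, a whole
    path stays on one chord. *)
Lemma stack_connect_surgery s t : connect e s t -> r t = r s \/ r t = E' (r s).
Proof.
have sK := pairingK (surgery_pairing pE ncE bdrank_ordR Euv).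
move=> /connectP[p pth ->]; elim: p s pth => [|t' p IHp] s /=; first by left.
move=> /andP[/stack_edge_surgery st /IHp]; case: st => ->; first by [].
by rewrite sK => -[]; [right | left].
Qed.

Lemma connect_lower_outer x : x != u -> x != v ->
  connect e (lower_point m x) (outer_point m x).
Proof.
case: x => [a|b] xu xv /=; last exact: connect0.
have aL : a != ordL i by move: xu; rewrite (inj_eq (@inl_inj _ _)).
have aR : a != ordR i by move: xv; rewrite (inj_eq (@inl_inj _ _)).
by apply/connect1; have := stack_edge_upper (inr a); rewrite tl_gen_inr.
Qed.

Lemma connect_outer_surgery x : connect e (outer_point m x) (outer_point m (E' x)).
Proof.
have [uv' Eu Ev [Evu EuEv _]] := surgery_distinct pE ncE bdrank_ordR Euv.
have [e1 e2 e3 e4 e5] := surgeryE pE ncE bdrank_ordR Euv.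
have cLE y : y != u -> y != v -> E y != u -> E y != v ->
    connect e (outer_point m y) (outer_point m (E y)).
  move=> yu yv Eyu Eyv; rewrite stack_connect_sym.
  apply: (connect_trans (y := lower_point m y)).
    rewrite stack_connect_sym; apply: (connect_trans (connect1 (stack_edge_lower y))).
    exact: connect_lower_outer.
  exact: connect_lower_outer.
have cEE : connect e (outer_point m (E u)) (outer_point m (E v)).
  apply: (connect_trans (y := lower_point m u)).
    rewrite stack_connect_sym; apply: (connect_trans (connect1 (stack_edge_lower u))).
    exact: connect_lower_outer.
  apply: (connect_trans (y := lower_point m v)).
    by have := connect1 (stack_edge_upper (inr (ordL i))); rewrite tl_gen_inrL.
  apply: (connect_trans (connect1 (stack_edge_lower v))).
  exact: connect_lower_outer.
have [xu|xv|xu|[xv|[xu xv xEu xEv]]] := surgery_cases E u v x.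
- rewrite xu e1; have := connect1 (stack_edge_upper (inl (ordL i))).
  by rewrite tl_gen_inlL.
- rewrite xv e2; have := connect1 (stack_edge_upper (inl (ordR i))).
  by rewrite tl_gen_inlR.
- by rewrite xu e3.
- by rewrite xv e4 stack_connect_sym.
have [Exu Exv _ _] := other_pairing pE xu xv xEu xEv.
by rewrite e5 //; exact: cLE.
Qed.

Lemma is_stack_surgery P : is_pairing P -> is_stack D E P = (P == E').
Proof.
move=> pP; have sP := surgery_pairing pE ncE bdrank_ordR Euv.
have rO x : r (outer_point m x) = x by case: x.
apply/idP/eqP => [/forallP h|->].
  apply/ffunP => x; have /forallP/(_ (E' x))/implyP := h x.
  rewrite connect_outer_surgery eq_sym (pairing_neq _ sP) => /(_ isT)/eqP.
  by move=> h'; apply/eqP; rewrite h'.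
apply/forallP => x; apply/forallP => y; apply/implyP => xy.
apply/eqP; apply/eqP/idP => [<-|]; first exact: connect_outer_surgery.
move=> /stack_connect_surgery; rewrite !rO => -[yx|-> //].
by rewrite yx eqxx in xy.
Qed.

(** Every component reaches an outer point, so none is a closed circle. *)
Lemma stack_loops0 : stack_loops D E = 0%N.
Proof.
have [uv' Eu Ev [Evu EuEv _]] := surgery_distinct pE ncE bdrank_ordR Euv.
have cO s : exists x, connect e s (outer_point m x).
  case: s => [[t|t]|j]; [by exists (inl t) | | by exists (inr j)].
  have [tu|tu] := eqVneq (inl t) u.
    exists (E u); apply: connect_trans (connect_lower_outer _ _) => //.
    by have := connect1 (stack_edge_lower u); rewrite -{1}tu.
  have [tv|tv] := eqVneq (inl t) v.
    exists (E v); apply: connect_trans (connect_lower_outer _ _) => //.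
    by have := connect1 (stack_edge_lower v); rewrite -{1}tv.
  by exists (inl t); exact: (connect_lower_outer tu tv).
apply/eqP; rewrite /stack_loops /n_comp_mem; apply/eqP/eq_card0 => s.
rewrite !inE; apply/negP => /andP[_ /forallP h]; have [x sx] := cO s.
by have := h (outer_point m x); rewrite sx; case: x {sx}.
Qed.

End StackTL.

(** * Exterior powers acting on spin vectors *)

Section AlternatingExtension.
Variables (F : fieldType) (m l : nat).
Implicit Types (J : 'I_l -> 'I_m) (w : {set 'I_m} -> F) (M : 'M[F]_m).

Definition occ J : {set 'I_m} := [set J r | r in 'I_l].

Definition set_slot J (r : 'I_l) (x : 'I_m) : 'I_l -> 'I_m :=
  fun s => if s == r then x else J s.

(* The sign of the permutation sorting J, or 0 if J is not injective. *)
Definition slot_sign J : int :=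
  \prod_(r < l) \prod_(s < l | (r < s)%N) Num.sg ((J s)%:Z - (J r)%:Z).

(** The coordinate at an arbitrary [J] of the antisymmetric tensor whose coordinates at increasing
    sequences are given by [w]. *)
Definition alt_ext w J : F :=
  \sum_(I : incr_seq m l) \det (mxsub J (val I) 1%:M) * w (occ (val I)).

Definition spin_vec w : 'cV[F]_#|{: incr_seq m l}| :=
  \col_I w (occ (val (enum_val I : incr_seq m l))).

(** With a Vandermonde determinant, permuting slots becomes permuting columns, which yields the sign
    rule. *)
Lemma slot_sign_det J :
  slot_sign J = Num.sg (\det (Vandermonde l (\row_r (J r)%:Z))).
Proof.
rewrite det_Vandermonde (big_morph Num.sg (@sgrM int) (sgr1 int)) /slot_sign.
apply: eq_bigr => r _; rewrite (big_morph Num.sg (@sgrM int) (sgr1 int)).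
by apply: eq_bigr => s _; rewrite !mxE.
Qed.

Lemma slot_sign_perm J (s : 'S_l) : slot_sign (J \o s) = (-1) ^+ s * slot_sign J.
Proof.
rewrite !slot_sign_det.
have -> : Vandermonde l (\row_r ((J \o s) r)%:Z) =
    col_perm s (Vandermonde l (\row_r (J r)%:Z)).
  by apply/matrixP => i j; rewrite !mxE.
rewrite col_permE det_mulmx det_perm odd_permV sgrM mulrC.
by congr (_ * _); rewrite sgrX sgrN1.
Qed.

Lemma slot_sign_incr J : {homo J : r s / (r < s)%N} -> slot_sign J = 1.
Proof.
move=> incJ; apply: big1 => r _; apply: big1 => s rs.
by rewrite gtr0_sg // subr_gt0 ltz_nat incJ.
Qed.

Lemma slot_sign_noninj J r s : r != s -> J r = J s -> slot_sign J = 0.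
Proof.
wlog rs : r s / (r < s)%N => [H rs e|_ e].
  have := rs; rewrite -val_eqE neq_ltn => /orP[h|h]; first exact: (H r s).
  by apply: (H s r); rewrite // eq_sym.
by rewrite /slot_sign (bigD1 r) //= (bigD1 s) //= e subrr sgr0 !mul0r.
Qed.

Lemma det_incr_unit (I I' : incr_seq m l) :
  \det (mxsub (val I) (val I') (1%:M : 'M[F]_m)) = (I == I')%:R.
Proof.
have /matrixP/(_ (enum_rank I) (enum_rank I')) := ext_mx1 F l m.
by rewrite !mxE !enum_rankK (inj_eq enum_rank_inj).
Qed.

Lemma alt_extE w J : alt_ext w J = (slot_sign J)%:~R * w (occ J).
Proof.
have [/injectiveP/incr_seq_of_inj[I [s JI]]|/injectivePn[r [s rs e]]] :=
    boolP (injectiveb J); last first.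
  rewrite (slot_sign_noninj rs e) mul0r; apply: big1 => I _.
  by rewrite (determinant_alternate rs) ?mul0r // => k; rewrite !mxE e.
have -> : occ J = occ (val I).
  apply/setP => x; apply/imsetP/imsetP => -[r _ ->]; first by exists (s r).
  by exists (s^-1%g r) => //; rewrite JI permKV.
have -> : slot_sign J = slot_sign (val I \o s).
  by apply: eq_bigr => r _; apply: eq_bigr => t _; rewrite /= !JI.
rewrite slot_sign_perm slot_sign_incr => [|r t rt]; last by rewrite incr_seqP.
rewrite mulr1 rmorphXn /= rmorphN1 /alt_ext (bigD1 I) //= big1 => [|I' I'I].
  rewrite addr0; congr (_ * _).
  have -> : mxsub J (val I) 1%:M = row_perm s (mxsub (val I) (val I) (1%:M : 'M[F]_m)).
    by apply/matrixP => i j; rewrite !mxE JI.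
  by rewrite row_permE det_mulmx det_perm det_incr_unit eqxx mulr1.
have -> : mxsub J (val I') 1%:M = row_perm s (mxsub (val I) (val I') (1%:M : 'M[F]_m)).
  by apply/matrixP => i j; rewrite !mxE JI.
by rewrite row_permE det_mulmx det_incr_unit eq_sym (negPf I'I) mulr0 mul0r.
Qed.

(** Expansion along row [r]: all other rows are rows of the identity, so the cofactors on both sides
    agree. *)
Lemma det_one_row M J (I : incr_seq m l) r :
  (forall s k, s != r -> M (J s) k = (J s == k)%:R) ->
  \det (mxsub J (val I) M) =
  \sum_x M (J r) x * \det (mxsub (set_slot J r x) (val I) 1%:M).
Proof.
move=> Mrow; have cof x c : cofactor (mxsub (set_slot J r x) (val I) 1%:M) r c =
    cofactor (mxsub J (val I) M) r c.
  rewrite /cofactor; congr (_ * determinant _); apply/matrixP => i j; rewrite !mxE.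
  have nr : lift r i != r by rewrite eq_sym neq_lift.
  by rewrite /set_slot (negPf nr) Mrow.
under eq_bigr => x _ do rewrite (expand_det_row _ r) mulr_sumr.
rewrite exchange_big (expand_det_row _ r) /=; apply: eq_bigr => c _.
under eq_bigr => x _ do rewrite cof mulrA.
rewrite -mulr_suml; congr (_ * _); rewrite mxE (bigD1 (val I c)) //= big1.
  by rewrite addr0 !mxE /set_slot !eqxx mulr1.
by move=> x xI; rewrite !mxE /set_slot eqxx (negPf xI) mulr0.
Qed.

Lemma ext_mx_spin_vec M w (I : incr_seq m l) :
  (ext_mx l M *m spin_vec w) (enum_rank I) ord0 =
  \sum_(I' : incr_seq m l) \det (mxsub (val I) (val I') M) * w (occ (val I')).
Proof.
rewrite mxE sum_incr_seq; apply: eq_bigr => k _; rewrite !mxE.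
by rewrite enum_rankK.
Qed.

Lemma ext_mx_spin_vec_row M w (I : incr_seq m l) r :
  (forall s k, s != r -> M (val I s) k = (val I s == k)%:R) ->
  (ext_mx l M *m spin_vec w) (enum_rank I) ord0 =
  \sum_x M (val I r) x * ((slot_sign (set_slot (val I) r x))%:~R *
                          w (occ (set_slot (val I) r x))).
Proof.
move=> Mrow; rewrite ext_mx_spin_vec.
under eq_bigr => I' _ do rewrite (det_one_row _ Mrow) mulr_suml.
rewrite exchange_big /=; apply: eq_bigr => x _.
by rewrite -alt_extE /alt_ext mulr_sumr; apply: eq_bigr => I' _; rewrite mulrA.
Qed.

Lemma ext_mx_spin_vec_id M w (I : incr_seq m l) :
  (forall s k, M (val I s) k = (val I s == k)%:R) ->
  (ext_mx l M *m spin_vec w) (enum_rank I) ord0 = w (occ (val I)).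
Proof.
move=> Mrow; rewrite ext_mx_spin_vec (bigD1 I) //= big1 => [|I' I'I].
  have -> : mxsub (val I) (val I) M = mxsub (val I) (val I) 1%:M.
    by apply/matrixP => i j; rewrite !mxE Mrow.
  by rewrite det_incr_unit eqxx mul1r addr0.
have -> : mxsub (val I) (val I') M = mxsub (val I) (val I') 1%:M.
  by apply/matrixP => i j; rewrite !mxE Mrow.
by rewrite det_incr_unit eq_sym (negPf I'I) mul0r.
Qed.

End AlternatingExtension.

Definition chi m d (X : {set 'I_m}) (x : bdpoint m d) : bool :=
  if x is inl t then t \in X else true.

Lemma occ_set_slot m l (J : 'I_l -> 'I_m) r x : injective J ->
  occ (set_slot J r x) = x |: occ J :\ J r.
Proof.
move=> injJ; apply/setP => y; rewrite !inE.
apply/imsetP/idP => [[s _ ->]|/orP[/eqP ->|/andP[yJ /imsetP[s _ ys]]]].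
- rewrite /set_slot; have [_|sr] := eqVneq s r; first by rewrite eqxx.
  by rewrite (inj_eq injJ) sr orbC imset_f.
- by exists r; rewrite // /set_slot eqxx.
- exists s; rewrite // /set_slot; case: eqVneq => // sr.
  by rewrite ys sr eqxx in yJ.
Qed.

Section SpinAction.
Variables (F : fieldType) (io : F) (m l : nat) (i : 'I_m.-1).
Hypothesis io2 : io * io = -1.
Implicit Types (w : {set 'I_m} -> F).

Definition cup_col : 'cV[F]_m :=
  \col_x ((x == ordL i)%:R + io * (x == ordR i)%:R).

Definition spin_mx : 'M[F]_m := 1%:M + cup_col *m cup_col^T.

Lemma spin_mxE x y : spin_mx x y = (x == y)%:R +
  ((x == ordL i)%:R + io * (x == ordR i)%:R) * ((y == ordL i)%:R + io * (y == ordR i)%:R).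
Proof. by rewrite !mxE big_ord1 !mxE. Qed.

Lemma spin_mx_other x y : x != ordL i -> x != ordR i -> spin_mx x y = (x == y)%:R.
Proof. by rewrite spin_mxE => /negPf -> /negPf ->; rewrite mulr0 addr0 mul0r addr0. Qed.

Lemma slot_sign_id n (I : incr_seq n l) r : slot_sign (set_slot (val I) r (val I r)) = 1.
Proof.
have e q : set_slot (val I) r (val I r) q = val I q.
  by rewrite /set_slot; case: eqVneq => // ->.
by apply: slot_sign_incr => s t st; rewrite !e incr_seqP.
Qed.

Lemma occ_set_slot_id n (I : incr_seq n l) r :
  occ (set_slot (val I) r (val I r)) = occ (val I).
Proof.
rewrite occ_set_slot ?setD1K ?imset_f //; exact: incr_seq_inj.
Qed.

Let LR : ordR i != ordL i.
Proof. by rewrite eq_sym ordL_neq_ordR. Qed.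

Lemma ext_spin_mx_neither w (I : incr_seq m l) :
  ordL i \notin occ (val I) -> ordR i \notin occ (val I) ->
  (ext_mx l spin_mx *m spin_vec l w) (enum_rank I) ord0 = w (occ (val I)).
Proof.
move=> LI RI; apply: ext_mx_spin_vec_id => s k; apply: spin_mx_other.
  by apply: contra LI => /eqP <-; rewrite imset_f.
by apply: contra RI => /eqP <-; rewrite imset_f.
Qed.

Lemma ext_spin_mx_left w (I : incr_seq m l) :
  ordL i \in occ (val I) -> ordR i \notin occ (val I) ->
  (ext_mx l spin_mx *m spin_vec l w) (enum_rank I) ord0 =
  w (occ (val I)) *+ 2 + io * w (ordR i |: occ (val I) :\ ordL i).
Proof.
move=> /imsetP[r _ Lr] RI; have injI := @incr_seq_inj _ _ I.
have IR s : val I s != ordR i by apply: contra RI => /eqP <-; rewrite imset_f.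
rewrite (@ext_mx_spin_vec_row _ _ _ _ _ _ r) => [|s k sr]; last first.
  by apply: spin_mx_other => //; rewrite Lr (inj_eq injI).
rewrite (bigD1 (ordL i)) //= (bigD1 (ordR i)) //= big1 => [|x /andP[xL xR]]; last first.
  have Lx : (ordL i == x) = false by rewrite eq_sym (negPf xL).
  by rewrite spin_mxE -Lr Lx (negPf xL) (negPf xR) !mulr0n; ring.
rewrite !spin_mxE -Lr !eqxx (negPf LR) (negPf (ordL_neq_ordR i)).
have eL : set_slot (val I) r (ordL i) = set_slot (val I) r (val I r) by rewrite -Lr.
rewrite eL slot_sign_id occ_set_slot_id occ_set_slot // -Lr.
(* Replacing [i] by its free neighbour [i+1] keeps the sequence increasing, so no sign appears. *)
rewrite slot_sign_incr => [|s t st]; first by rewrite !mulr0n !mulr1n mulr1z; ring.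
rewrite /set_slot; have [sr|sr] := eqVneq s r; have [tr|tr] := eqVneq t r.
- by move: st; rewrite sr tr ltnn.
- have := IR t; rewrite -val_eqE /=; move: st; rewrite sr -(incr_seqP I) -Lr /=.
  by rewrite leq_eqVlt eq_sym => /orP[->|].
- by apply: ltnW; rewrite /= ltnS; move: st; rewrite tr -(incr_seqP I) -Lr.
- by rewrite incr_seqP.
Qed.

Lemma ext_spin_mx_right w (I : incr_seq m l) :
  ordL i \notin occ (val I) -> ordR i \in occ (val I) ->
  (ext_mx l spin_mx *m spin_vec l w) (enum_rank I) ord0 =
  io * w (ordL i |: occ (val I) :\ ordR i).
Proof.
move=> LI /imsetP[r _ Rr]; have injI := @incr_seq_inj _ _ I.
have IL s : val I s != ordL i by apply: contra LI => /eqP <-; rewrite imset_f.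
rewrite (@ext_mx_spin_vec_row _ _ _ _ _ _ r) => [|s k sr]; last first.
  by apply: spin_mx_other => //; rewrite Rr (inj_eq injI).
(* Only this term survives: the diagonal entry at [ordR i] is [1 + io * io = 0]. *)
rewrite (bigD1 (ordL i)) //= big1 => [|x xL]; last first.
  rewrite spin_mxE -Rr eqxx (negPf xL) (negPf LR) (eq_sym (ordR i)) !mulr0n.
  rewrite !add0r mulr1n mulr1 mulrA io2 mulN1r subrr mul0r //.
rewrite !spin_mxE -Rr !eqxx (negPf LR) (negPf (ordL_neq_ordR i)).
rewrite occ_set_slot // -Rr.
rewrite slot_sign_incr => [|s t st]; first by rewrite !mulr0n !mulr1n mulr1z; ring.
rewrite /set_slot; have [sr|sr] := eqVneq s r; have [tr|tr] := eqVneq t r.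
- by move: st; rewrite sr tr ltnn.
- by apply: ltnW; move: st; rewrite sr -(incr_seqP I) -Rr.
- have := IL s; rewrite -val_eqE /=; move: st; rewrite tr -(incr_seqP I) -Rr /=.
  by rewrite ltnS leq_eqVlt => /orP[->|].
- by rewrite incr_seqP.
Qed.

(** The bordered matrix [A] times a unipotent factor is block lower triangular in one way and block
    upper triangular in another. *)
Lemma det_add_rank1 n (x : 'cV[F]_n) (y : 'rV[F]_n) :
  \det (1%:M + x *m y) = 1 + (y *m x) ord0 ord0.
Proof.
pose A := block_mx (1%:M : 'M_1) (- y) x 1%:M.
have e1 : A *m block_mx (1%:M : 'M_1) y 0 1%:M = block_mx 1%:M 0 x (1%:M + x *m y).
  rewrite mulmx_block !mulmx1 !mul1mx !mulmx0 !addr0 subrr; congr block_mx.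
  by rewrite addrC.
have e2 : A *m block_mx (1%:M : 'M_1) 0 (- x) 1%:M = block_mx (1%:M + y *m x) (- y) 0 1%:M.
  by rewrite mulmx_block !mulmx1 !mul1mx !mulmx0 mulNmx mulmxN opprK !add0r subrr.
have := congr1 determinant e1; have := congr1 determinant e2.
rewrite !det_mulmx !det_lblock !det_ublock !det1 !mulr1 !mul1r => -> <-.
by rewrite det_mx11 !mxE mulr1n.
Qed.

(** The rows indexed by [I] differ from the identity only in columns [i] and [i+1], both in [I].
    Hence each minor factors through the principal one, whose determinant is [1 + w^T w = 1]. *)
Lemma ext_spin_mx_both w (I : incr_seq m l) :
  ordL i \in occ (val I) -> ordR i \in occ (val I) ->
  (ext_mx l spin_mx *m spin_vec l w) (enum_rank I) ord0 = w (occ (val I)).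
Proof.
move=> LI RI; rewrite ext_mx_spin_vec.
have factor (I' : incr_seq m l) : mxsub (val I) (val I') spin_mx =
    mxsub (val I) (val I) spin_mx *m mxsub (val I) (val I') 1%:M.
  apply/matrixP => r c; rewrite [LHS]mxE [RHS]mxE.
  have [/imsetP[s _ es]|cI] := boolP (val I' c \in occ (val I)).
    rewrite (bigD1 s) //= big1 ?addr0 => [|t ts].
      by rewrite [X in _ = X * _]mxE [X in _ = _ * X]mxE es [X in _ = _ * X]mxE eqxx mulr1.
    rewrite [X in _ * X]mxE [X in _ * X]mxE es (inj_eq (@incr_seq_inj _ _ I)) (negPf ts).
    by rewrite mulr0.
  have cne t : val I t != val I' c by apply: contra cI => /eqP <-; rewrite imset_f.
  rewrite big1 => [|t _]; last by rewrite [X in _ * X]mxE [X in _ * X]mxE (negPf (cne t)) mulr0.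
  have cL : val I' c != ordL i by apply: contra cI => /eqP ->.
  have cR : val I' c != ordR i by apply: contra cI => /eqP ->.
  by rewrite spin_mxE (negPf (cne r)) (negPf cL) (negPf cR) !mulr0n; ring.
have det1' : \det (mxsub (val I) (val I) spin_mx) = 1.
  pose x : 'cV[F]_l := \col_r cup_col (val I r) ord0.
  have -> : mxsub (val I) (val I) spin_mx = 1%:M + x *m x^T.
    apply/matrixP => r c; rewrite mxE spin_mxE !mxE big_ord1 !mxE.
    by rewrite (inj_eq (@incr_seq_inj _ _ I)).
  rewrite det_add_rank1 mxE.
  move/imsetP: LI => [r _ Lr]; move/imsetP: RI => [s _ Rs].
  have sr : s != r by apply: contra LR => /eqP sr; rewrite Rs sr -Lr.
  have injI := @incr_seq_inj _ _ I.
  rewrite (bigD1 r) //= (bigD1 s) //= big1 => [|t /andP[tr ts]].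
    rewrite !mxE -Lr -Rs !eqxx (negPf LR) (negPf (ordL_neq_ordR i)) !mulr0n !mulr1n.
    by rewrite !mulr0 !mulr1 !add0r !addr0 io2 mulr1 subrr addr0.
  by rewrite !mxE Lr Rs !(inj_eq injI) (negPf tr) (negPf ts) !mulr0n; ring.
rewrite (bigD1 I) //= big1 => [|I' I'I].
  by rewrite factor det_mulmx det1' det_incr_unit eqxx !mul1r addr0.
by rewrite factor det_mulmx det_incr_unit eq_sym (negPf I'I) mulr0 mul0r.
Qed.

(** The right side is the action of [1 + io e_i] on a diagram, with closed circles worth [0]; the
    four cases are the occupations of [i] and [i+1]. *)
Lemma ext_spin_mx_weight d (E : {ffun bdpoint m d -> bdpoint m d}) (I : incr_seq m l) :
  is_pairing E -> noncrossing E ->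
  (ext_mx l spin_mx *m spin_vec l (fun X => weight io E (chi X))) (enum_rank I) ord0 =
  weight io E (chi (occ (val I))) +
  io * (if E (inl (ordL i)) == inl (ordR i) then 0
        else weight io (surgery E (inl (ordL i)) (inl (ordR i))) (chi (occ (val I)))).
Proof.
move=> pE ncE; set X := occ (val I).
set u : bdpoint m d := inl (ordL i); set v : bdpoint m d := inl (ordR i).
have uv : bdrank v = (bdrank u).+1 by [].
have wt_same : chi X u = chi X v ->
    (if E u == v then 0 else weight io (surgery E u v) (chi X)) = 0.
  move=> e; case: ifPn => // Euv.
  (* [c true] and [c false] only instantiate [weight_surgery], whose third conclusion holds for
     every [ch]. *)
  pose c (b : bool) (x : bdpoint m d) := if x == u then b else if x == v then ~~ b else true.
  have vu : v == u = false by rewrite (inj_eq (@inl_inj _ _)) (negPf LR).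
  have [] := @weight_surgery _ io m d io2 E u v pE ncE uv (c true) (c false).
  - by rewrite /c eqxx.
  - by rewrite /c vu eqxx.
  - by rewrite /c eqxx.
  - by rewrite /c vu eqxx.
  - by move=> x /negPf xu /negPf xv; rewrite /c xu xv.
  - by [].
  by move=> _ _; apply.
have [LX|LX] := boolP (ordL i \in X); have [RX|RX] := boolP (ordR i \in X).
- by rewrite ext_spin_mx_both // wt_same ?mulr0 ?addr0 //= LX RX.
- rewrite ext_spin_mx_left //.
  set X' := ordR i |: X :\ ordL i.
  have c1 : chi X u by [].
  have c2 : ~~ chi X v by [].
  have c3 : ~~ chi X' u by rewrite /= !inE eqxx eq_sym (negPf LR).
  have c4 : chi X' v by rewrite /= !inE eqxx.
  have c5 x : x != u -> x != v -> chi X' x = chi X x.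
    by case: x => //= a; rewrite !(inj_eq (@inl_inj _ _)) !inE => /negPf -> /negPf ->.
  case: eqVneq => [Euv|Euv].
    rewrite (weight_adjacent io pE uv c1 c2 c3 c4 c5 Euv) mulrA io2 mulr0 addr0.
    by rewrite mulN1r mulr2n addrK.
  have [-> _ _] := weight_surgery io2 pE ncE uv c1 c2 c3 c4 c5 Euv.
  by rewrite mulNr mulrN mulrA io2 mulN1r opprK mulr2n addrA.
- rewrite ext_spin_mx_right //.
  set X' := ordL i |: X :\ ordR i.
  have c1 : chi X' u by rewrite /= !inE eqxx.
  have c2 : ~~ chi X' v by rewrite /= !inE eqxx (negPf LR).
  have c3 : ~~ chi X u by [].
  have c4 : chi X v by [].
  have c5 x : x != u -> x != v -> chi X x = chi X' x.
    by case: x => //= a; rewrite !(inj_eq (@inl_inj _ _)) !inE => /negPf -> /negPf ->.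
  case: eqVneq => [Euv|Euv].
    by rewrite (weight_adjacent io pE uv c1 c2 c3 c4 c5 Euv) mulr0 addr0.
  have [_ -> _] := weight_surgery io2 pE ncE uv c1 c2 c3 c4 c5 Euv.
  by rewrite mulrDr mulrA io2 mulN1r addrCA subrr addr0.
- by rewrite ext_spin_mx_neither // wt_same ?mulr0 ?addr0 //= (negPf LX) (negPf RX).
Qed.

End SpinAction.

(** * The contraction by the annihilator of the first homology *)

Section Contraction.
Variables (F : fieldType) (io : F) (m d : nat).
Hypothesis io2 : io * io = -1.
Variable E : {ffun bdpoint m d -> bdpoint m d}.
Hypotheses (pE : is_pairing E) (ncE : noncrossing E).

Let EK : involutive E := pairingK pE.

Section Arc.
Variables (p q : 'I_m) (K : {set 'I_m}).
Hypotheses (pq : (p < q)%N) (Epq : E (inl p) = inl q).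
Hypothesis transv : forall t, t != p -> t != q ->
  chi K (inl t : bdpoint m d) != chi K (E (inl t)).

Let Eqp : E (inl q) = inl p. Proof. by rewrite -Epq EK. Qed.

Let T := [set t : 'I_m | (p < t < q)%N].

Lemma arc_card : #|T| = (q - p.+1)%N.
Proof.
rewrite -sum1_card (eq_bigl (fun t : 'I_m => (p.+1 <= t)%N && (t < q)%N)); last first.
  by move=> t; rewrite inE.
rewrite -(big_ord_widen_cond _ (fun t => (p.+1 <= t)%N) (fun=> 1%N)); last exact/ltnW/ltn_ord.
rewrite -[RHS]muln1 -sum_nat_const_nat [RHS]big_geq_mkord.
exact: eq_bigl.
Qed.

(* Inside an arc every chord has both ends there, so exactly half of the
   points are occupied. *)
Lemma arc_occupation : (#|[set t in K | p < t < q]| * 2 = q - p.+1)%N.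
Proof.
(* The default [t] covers points joined to the bottom edge; none of them lies under the arc. *)
pose f (t : 'I_m) := if E (inl t) is inl t' then t' else t.
have fK : involutive f.
  move=> t; rewrite /f; case e: (E (inl t)) => [t'|j]; last by rewrite e.
  by rewrite -e EK.
have ET t : t \in T -> E (inl t) = inl (f t) /\ f t \in T.
  rewrite !inE => /andP[pt tq]; have := (noncrossingP pE ncE) (inl p) (inl t).
  rewrite Epq !(inj_eq (@inl_inj _ _)) -!val_eqE /= gtn_eqF // ltn_eqF // => /(_ isT isT).
  rewrite /separates Epq /= pt ltnNge (ltnW tq) /= => /esym.
  have ne : E (inl t) != inl q.
    rewrite -Epq (inj_eq (inv_inj EK)) (inj_eq (@inl_inj _ _)) -val_eqE /=.
    by rewrite gtn_eqF.
  have := ltn_ord q; move: ne; rewrite /f; case: (E (inl t)) => [t'|j].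
    rewrite (inj_eq (@inl_inj _ _)) -val_eqE /= => ne _ h; split=> //.
    move: ne h; clear -pq; move: (nat_of_ord t') (nat_of_ord p) (nat_of_ord q) pq.
    by move=> a b c; lia.
  move=> /= _ qm; move: (d - j.+1)%N pq qm; clear.
  by move: (nat_of_ord p) (nat_of_ord q) => a b c; lia.
have fT t : (f t \in T) = (t \in T).
  by apply/idP/idP => [/ET[_]|/ET[_ //]]; rewrite fK.
have half t : t \in T -> ((t \in K) + (f t \in K) = 1)%N.
  move=> tT; have [Et ftT] := ET t tT.
  have := transv (t := t); rewrite Et /= => h; move: tT; rewrite inE => /andP[pt tq].
  have := h; rewrite -!val_eqE /= gtn_eqF // ltn_eqF // => /(_ isT isT).
  by case: (t \in K); case: (f t \in K).
have cT : #|T| = (\sum_(t in T) (t \in K) + \sum_(t in T) (f t \in K))%N.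
  by rewrite -sum1_card -big_split; apply: eq_bigr => t tT; rewrite /= half.
have fK' : (\sum_(t in T) (f t \in K) = \sum_(t in T) (t \in K))%N.
  rewrite (reindex_inj (inv_inj fK)) /=.
  by apply: eq_big => [t|t _]; rewrite ?fT ?fK.
rewrite -arc_card cT fK' addnn -muln2.
suff -> : (\sum_(t in T) (t \in K) = #|[set t in K | (p < t < q)%N]|)%N by [].
rewrite -sum1_card [RHS]big_mkcond [LHS]big_mkcond /=; apply: eq_bigr => t _.
by rewrite !inE; case: (t \in K); case: (p < t)%N; case: (t < q)%N.
Qed.

End Arc.

(** The sign of moving [x] from the front of the increasing list of [K] to its sorted place, or [0]
    if [x] lies in [K]. *)
Definition kappa (K : {set 'I_m}) (x : nat) : int :=
  \prod_(t in K) Num.sg ((t : nat)%:Z - x%:Z).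

Lemma kappa_arc (K : {set 'I_m}) (p q : 'I_m) : (p < q)%N -> p \notin K -> q \notin K ->
  kappa K q = (-1) ^+ #|[set t in K | (p < t < q)%N]| * kappa K p.
Proof.
move=> pq pK qK; rewrite /kappa.
rewrite (eq_bigr (fun t : 'I_m => (if (p < t < q)%N then -1 else 1) *
    Num.sg ((t : nat)%:Z - (p : nat)%:Z))).
  rewrite big_split /=; congr (_ * _); rewrite -big_mkcondr /= -prodr_const.
  by apply: eq_bigl => t; rewrite inE.
move=> t tK; have tp : t != p by apply: contra pK => /eqP <-.
have tq : t != q by apply: contra qK => /eqP <-.
move: tp tq; rewrite -!val_eqE /=; move: (nat_of_ord t) (nat_of_ord p) (nat_of_ord q) pq.
move=> a b c bc ab ac; case: ifPn => h; rewrite ?mul1r ?mulN1r.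
  move/andP: h => [ba ac']; rewrite [in RHS]gtr0_sg ?subr_gt0 ?ltz_nat //.
  by rewrite ltr0_sg // subr_lt0 ltz_nat.
have [ba|ba] := ltnP b a.
  by rewrite !gtr0_sg // subr_gt0 ltz_nat //; move: h ac; rewrite ba -leqNgt; lia.
have {}ba : (a < b)%N by rewrite ltn_neqAle ab.
by rewrite !ltr0_sg // subr_lt0 ltz_nat // (ltn_trans ba).
Qed.

Lemma weight_arc_eq0 (X : {set 'I_m}) (x : bdpoint m d) :
  chi X x = chi X (E x) -> weight io E (chi X) = 0.
Proof. by move=> e; rewrite /weight (bigD1 x) //= /end_weight e eqxx mul0r. Qed.

Lemma weight_neq0 (X : {set 'I_m}) (x : bdpoint m d) :
  weight io E (chi X) != 0 -> chi X x != chi X (E x).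
Proof. by apply: contraNneq => /weight_arc_eq0 ->. Qed.

(** Only [x = p] and [x = q] contribute. If [c] points of [K] lie between them, [arc_occupation]
    gives [q = p + 2c + 1]; with the end weight [io] the powers of [io] differ by [(-1)^(c+1)], and
    [kappa_arc] supplies [(-1)^c], so the two terms cancel. *)
Lemma contraction_arc (K : {set 'I_m}) (p q : 'I_m) :
  (p < q)%N -> p \notin K -> q \notin K -> E (inl p) = inl q ->
  (forall x, x != inl p -> x != inl q -> chi K x != chi K (E x)) ->
  \sum_(x : 'I_m) io ^+ x * ((kappa K x)%:~R * weight io E (chi (x |: K))) = 0.
Proof.
move=> pq pK qK Epq transv; have Eqp : E (inl q) = inl p by rewrite -Epq EK.
have qp : q != p by rewrite -val_eqE gtn_eqF.
have pq' : p == q = false by rewrite eq_sym (negPf qp).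
rewrite (bigD1 p) //= (bigD1 q) //= big1 => [|x /andP[xp xq]]; last first.
  rewrite (@weight_arc_eq0 _ (inl p)) ?mulr0 // Epq /= !inE.
  by rewrite (negPf pK) (negPf qK) !(eq_sym _ x) (negPf xp) (negPf xq).
pose rest := \prod_(x | (x != inl p) && (x != inl q)) end_weight io E (chi K) x.
have restE y : y = p \/ y = q ->
    \prod_(x | (x != inl p) && (x != inl q)) end_weight io E (chi (y |: K)) x = rest.
  move=> ypq; apply: eq_bigr => x /andP[xp xq].
  have chiE z : z != inl p -> z != inl q -> chi (y |: K) z = chi K z.
    case: z => //= t; rewrite !(inj_eq (@inl_inj _ _)) => tp tq.
    by rewrite !inE; case: ypq => ->; rewrite ?(negPf tp) ?(negPf tq).
  have Exp : E x != inl p by apply: contra xq => /eqP e; rewrite -Epq -e EK.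
  have Exq : E x != inl q by apply: contra xp => /eqP e; rewrite -Eqp -e EK.
  by rewrite /end_weight !chiE.
have qp1 : inl q != inl p :> bdpoint m d by rewrite (inj_eq (@inl_inj _ _)).
have wp : weight io E (chi (p |: K)) = rest.
  rewrite /weight (bigD1 (inl p)) //= (bigD1 (inl q)) //= restE; last by left.
  rewrite /end_weight Epq Eqp /= !inE eqxx (negPf qp) (negPf qK) /=.
  by rewrite ltnNge (ltnW pq) /= !mul1r.
have wq : weight io E (chi (q |: K)) = io * rest.
  rewrite /weight (bigD1 (inl p)) //= (bigD1 (inl q)) //= restE; last by right.
  rewrite /end_weight Epq Eqp /= !inE eqxx pq' (negPf pK) /=.
  by rewrite pq mul1r.
rewrite wp wq (kappa_arc pq pK qK) addr0 rmorphM rmorphXn rmorphN1 /=.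
have transv' t : t != p -> t != q -> chi K (inl t : bdpoint m d) != chi K (E (inl t)).
  by move=> tp tq; apply: transv; rewrite (inj_eq (@inl_inj _ _)).
have := arc_occupation pq Epq transv'; set c := #|_| => cE.
have -> : nat_of_ord q = (p + (c * 2).+1)%N by rewrite cE; clear -pq; lia.
rewrite exprD exprS mulnC exprM expr2 io2.
have s2 : (-1) ^+ c * (-1) ^+ c = 1 :> F by rewrite -exprMn mulrNN mulr1 expr1n.
rewrite (_ : _ * _ * (_ * _) = io ^+ p * ((kappa K p)%:~R * rest) * (io * io) *
  ((-1) ^+ c * (-1) ^+ c)); last by ring.
by rewrite s2 io2 mulr1 mulrN1 subrr.
Qed.

(** If [p |: K] has nonzero weight, every chord has exactly one singled-out end. Removing [p]
    empties one chord, which joins two top points because bottom points are always singled out. *)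
Lemma contraction_eq0 (K : {set 'I_m}) :
  \sum_(x : 'I_m) io ^+ x * ((kappa K x)%:~R * weight io E (chi (x |: K))) = 0.
Proof.
have [/existsP[p /andP[pK wp]]|/existsPn h] :=
  boolP [exists p, (p \notin K) && (weight io E (chi (p |: K)) != 0)]; last first.
  apply: big1 => x _; have := h x; rewrite negb_and !negbK => /orP[xK|/eqP ->].
    by rewrite /kappa (bigD1 x) //= subrr sgr0 mul0r mulr0z mul0r mulr0.
  by rewrite !mulr0.
have trp x := weight_neq0 x wp.
have [q Epq] : exists q, E (inl p) = inl q.
  have := trp (inl p); case: (E (inl p)) => [q|j] /=; first by exists q.
  by rewrite !inE eqxx.
have Eqp : E (inl q) = inl p by rewrite -Epq EK.
have qp : q != p.
  by have := pairing_neq (inl p) pE; rewrite Epq (inj_eq (@inl_inj _ _)).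
have qK : q \notin K.
  by have := trp (inl p); rewrite Epq /= !inE eqxx (negPf qp).
have trK x : x != inl p -> x != inl q -> chi K x != chi K (E x).
  move=> xp xq; have Exp : E x != inl p by apply: contra xq => /eqP e; rewrite -Epq -e EK.
  have chiE z : z != inl p -> chi (p |: K) z = chi K z.
    by case: z => //= t; rewrite (inj_eq (@inl_inj _ _)) !inE => /negPf ->.
  by have := trp x; rewrite !chiE.
have [pq|qp'|e] := ltngtP p q; first exact: (contraction_arc pq pK qK Epq trK).
  by apply: (contraction_arc qp' qK pK Eqp) => x xq xp; exact: trK.
by move: qp; rewrite -val_eqE /= e eqxx.
Qed.

(** The projection along the first basis vector onto the kernel of the form with coordinates
    [io ^+ y]. *)
Definition proj_mx : 'M[F]_m :=
  \matrix_(x, y) ((x == y)%:R - ((x : nat) == 0%N)%:R * io ^+ y).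

(** Only the row of [0] differs from the identity. If [0] occurs in [I], that row subtracts a
    contraction, which vanishes by [contraction_eq0]. *)
Lemma ext_proj_mx_weight l (I : incr_seq m l) :
  (ext_mx l proj_mx *m spin_vec l (fun X => weight io E (chi X))) (enum_rank I) ord0 =
  weight io E (chi (occ (val I))).
Proof.
have injI := @incr_seq_inj _ _ I.
have [/existsP[r /eqP r0]|/existsPn h] := boolP [exists r, (val I r : nat) == 0%N]; last first.
  by apply: ext_mx_spin_vec_id => s k; rewrite mxE (negPf (h s)) mul0r subr0.
have rmin s : s != r -> (r < s)%N.
  move=> sr; rewrite -(incr_seqP I) r0 lt0n; apply: contra sr => /eqP s0.
  by apply/eqP/injI/val_inj; rewrite /= s0 r0.
rewrite (@ext_mx_spin_vec_row _ _ _ _ _ _ r) => [|s k sr]; last first.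
  have := rmin s sr; rewrite -(incr_seqP I) r0 lt0n => /negPf s0.
  by rewrite mxE s0 mul0r subr0.
under eq_bigr => x _ do rewrite mxE r0 eqxx mulrBl.
rewrite sumrB (bigD1 (val I r)) //= big1 => [|x /negPf xr]; last first.
  by rewrite eq_sym xr mul0r.
rewrite eqxx slot_sign_id occ_set_slot_id addr0 ?mulr1n ?mulr1z !mul1r.
pose K := occ (val I) :\ val I r.
pose c : int := \prod_(s < l | s != r) \prod_(t < l | (s < t)%N)
   Num.sg ((val I t : nat)%:Z - (val I s : nat)%:Z).
(* Pairs of slots involving [r], the first slot, give [kappa K x]; the other pairs do not depend on
   [x]. *)
have signE x : slot_sign (set_slot (val I) r x) = kappa K x * c.
  rewrite /slot_sign (bigD1 r) //=; congr (_ * _).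
    rewrite /kappa (_ : K = [set val I s | s in [pred s : 'I_l | (r < s)%N]]); last first.
      apply/setP => y; rewrite !inE; apply/andP/imsetP.
        move=> [yr /imsetP[s _ ys]]; exists s => //; rewrite inE; apply: rmin.
        by apply: contra yr => /eqP sr; rewrite ys sr.
      move=> [s]; rewrite inE => rs ->; rewrite imset_f // (inj_eq injI); split=> //.
      by apply: contraTneq rs => ->; rewrite ltnn.
    rewrite big_imset /=; last by move=> s t _ _; exact: injI.
    apply: eq_big => s; rewrite ?inE // => rs.
    by rewrite /set_slot eqxx (negPf (_ : s != r)) //; apply: contraTneq rs => ->; rewrite ltnn.
  apply: eq_bigr => s sr; apply: eq_bigr => t st; rewrite /set_slot (negPf sr).
  rewrite (negPf (_ : t != r)) //; apply: contraTneq st => ->.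
  by rewrite -leqNgt ltnW // rmin.
rewrite -[RHS]subr0; congr (_ - _).
transitivity ((\sum_(x : 'I_m) io ^+ x *
    ((kappa K x)%:~R * weight io E (chi (x |: K)))) * c%:~R); last first.
  by rewrite contraction_eq0 mul0r.
rewrite mulr_suml; apply: eq_bigr => x _.
by rewrite signE occ_set_slot // rmorphM /= mul1r -/K; ring.
Qed.

End Contraction.

(** * Independence of the spin vectors *)

Section Closers.
Variables (m d : nat).
Implicit Types (x y z : bdpoint m d) (p : {ffun bdpoint m d -> bdpoint m d}).

Definition closer p x : bool := (bdrank (p x) < bdrank x)%N.

Lemma noncrossing_between p x z : is_pairing p -> noncrossing p ->
  (bdrank x < bdrank z)%N -> (bdrank z < bdrank (p x))%N ->
  (bdrank x < bdrank (p z))%N /\ (bdrank (p z) < bdrank (p x))%N.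
Proof.
move=> pp nc xz zpx; have pK := pairingK pp.
have := (noncrossingP pp nc) x z; rewrite -!bdrank_eq gtn_eqF // ltn_eqF //.
move=> /(_ isT isT); rewrite /separates xz ltnNge (ltnW zpx) /=.
have ne : bdrank (p z) != bdrank (p x).
  by rewrite bdrank_eq (inj_eq (inv_inj pK)) -bdrank_eq gtn_eqF.
move: ne xz zpx; move: (bdrank x) (bdrank z) (bdrank (p x)) (bdrank (p z)).
by move=> a b c e; clear; lia.
Qed.

Lemma closer_pairing p x : is_pairing p -> closer p (p x) = ~~ closer p x.
Proof.
move=> pp; rewrite /closer (pairingK pp) -leqNgt [RHS]leq_eqVlt.
by rewrite bdrank_eq eq_sym (negPf (pairing_neq x pp)).
Qed.

(** As with balanced parentheses, the last ends determine the chords. By induction on length, the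
    chords under the chord of [x] agree, so [p' x] cannot fall strictly inside it, nor beyond it, as
    [p' (p x)] would then fall inside. *)
Lemma closer_inj p p' : is_pairing p -> noncrossing p ->
  is_pairing p' -> noncrossing p' -> closer p =1 closer p' -> p = p'.
Proof.
move=> pp nc pp' nc' ecl; have pK := pairingK pp; have pK' := pairingK pp'.
have opener n x : (bdrank (p x) - bdrank x < n)%N -> ~~ closer p x -> p' x = p x.
  elim: n x => // n IHn x gap xop.
  have xpx : (bdrank x < bdrank (p x))%N.
    by move: xop; rewrite -closer_pairing // /closer pK.
  have inside z : (bdrank x < bdrank z)%N -> (bdrank z < bdrank (p x))%N -> p' z = p z.
    move=> xz zpx; have [xpz pzpx] := noncrossing_between pp nc xz zpx.
    have [zcl|zop] := boolP (closer p z); last first.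
      apply: IHn zop; move: gap xz zpx xpz pzpx.
      move: (bdrank x) (bdrank z) (bdrank (p x)) (bdrank (p z)) => a b c e; clear; lia.
    suff e : p' (p z) = z by rewrite -{1}e pK'.
    rewrite IHn ?pK //; last by rewrite closer_pairing // zcl.
    move: gap xz zpx xpz pzpx.
    move: (bdrank x) (bdrank z) (bdrank (p x)) (bdrank (p z)) => a b c e; clear; lia.
  have xpx' : (bdrank x < bdrank (p' x))%N.
    by move: xop; rewrite ecl -closer_pairing // /closer pK'.
  case: (ltngtP (bdrank (p' x)) (bdrank (p x))) => [lt|gt|/bdrank_inj //].
    have := inside _ xpx' lt; rewrite pK' => xE.
    by have [] := noncrossing_between pp nc xpx' lt; rewrite -xE ltnn.
  have [h1 h2] := noncrossing_between pp' nc' xpx gt.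
  have h3 : (bdrank (p' (p x)) < bdrank (p x))%N.
    by rewrite -[(_ < _)%N]/(closer p' (p x)) -ecl closer_pairing.
  have := inside _ h1 h3; rewrite pK' => pxE.
  by have [_] := noncrossing_between pp nc h1 h3; rewrite -pxE ltnn.
apply/ffunP => x; have [xcl|xop] := boolP (closer p x); last by rewrite (opener _ x (ltnSn _)).
have e : p' (p x) = p (p x) by apply: (opener _ _ (ltnSn _)); rewrite closer_pairing // xcl.
by rewrite pK in e; rewrite -{2}e pK'.
Qed.

Definition rank_sum (c : bdpoint m d -> bool) : nat := (\sum_x c x * bdrank x)%N.

(* The set of last ends has the largest rank sum among all choices of one end
   per chord; this triangularity is what makes spin vectors independent. *)
Lemma rank_sum_closer p (c : bdpoint m d -> bool) : is_pairing p ->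
  (forall x, c x != c (p x)) ->
  (rank_sum c <= rank_sum (closer p))%N /\
  (rank_sum c = rank_sum (closer p) -> c =1 closer p).
Proof.
move=> pp tr; have pK := pairingK pp.
(* Counting each chord from both ends permits a termwise comparison without choosing an end per
   chord. *)
have dbl (b : bdpoint m d -> bool) :
    (rank_sum b * 2 = \sum_x (b x * bdrank x + b (p x) * bdrank (p x)))%N.
  rewrite muln2 -addnn big_split /=; congr (_ + _)%N.
  by rewrite /rank_sum (reindex_inj (inv_inj pK)).
have key : (rank_sum c * 2 <= rank_sum (closer p) * 2
    ?= iff [forall x, c x == closer p x])%N.
  rewrite !dbl; have := @leqif_sum _ xpredT (fun x => c x == closer p x)
    (fun x => c x * bdrank x + c (p x) * bdrank (p x))%N
    (fun x => closer p x * bdrank x + closer p (p x) * bdrank (p x))%N.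
  apply=> x _; have cpx : c (p x) = ~~ c x by have := tr x; case: (c x); case: (c (p x)).
  rewrite closer_pairing // cpx /closer.
  have := pairing_neq x pp; rewrite -bdrank_eq.
  move: (bdrank x) (bdrank (p x)) => a b ab; case: (c x); rewrite /leqif /=;
    case: (ltngtP b a) ab => //= h _; rewrite ?mul0n ?mul1n ?add0n ?addn0 ?eqxx ?leqnn //;
    by rewrite ltnW // ltn_eqF.
split=> [|e]; first by have := key.1; rewrite leq_mul2r.
by have := key.2; rewrite e eqxx => /esym/forallP h x; exact/eqP.
Qed.

Definition closers p : {set 'I_m} := [set t | closer p (inl t)].

(** Bottom points are matched with top points, which have smaller rank, so they are last ends, in
    accordance with [chi]. *)
Lemma chi_closers p : basis_diagram p -> chi (closers p) =1 closer p.
Proof.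
move=> /and3P[_ _ /forallP top] [t|j] /=; first by rewrite inE.
rewrite /closer; have := top j; case: (p (inr j)) => //= t _.
by rewrite (leq_trans (ltn_ord t)) // leq_addr.
Qed.

(** Half of the [m + d] points are last ends, and these include the [d] bottom points. *)
Lemma card_closers p : basis_diagram p -> (2 * #|closers p| = m - d)%N.
Proof.
move=> bp; have cE := chi_closers bp; have /and3P[pp _ _] := bp.
have h1 : (\sum_x closer p x = #|closers p| + d)%N.
  rewrite big_sumType /=; congr (_ + _)%N.
    rewrite -sum1_card [RHS]big_mkcond /=; apply: eq_bigr => t _.
    by rewrite inE; case: (closer _ _).
  under eq_bigr => j _ do rewrite -cE.
  by rewrite sum_nat_const card_ord muln1.
have h2 : (\sum_x closer p x + \sum_x closer p x = m + d)%N.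
  rewrite [in X in (_ + X)%N](reindex_inj (inv_inj (pairingK pp))) -big_split /=.
  rewrite (eq_bigr (fun=> 1%N)) => [|x _].
    by rewrite sum_nat_const muln1 card_sum !card_ord.
  by rewrite closer_pairing //; case: (closer _ _).
by move: h2; rewrite h1; clear; lia.
Qed.

End Closers.

Lemma incr_seq_of_set m l (X : {set 'I_m}) : #|X| = l ->
  exists I : incr_seq m l, occ (val I) = X.
Proof.
move=> cX; pose f (r : 'I_l) := enum_val (cast_ord (esym cX) r).
have injf : injective f by move=> r s /enum_val_inj/cast_ord_inj.
have [I [s fI]] := incr_seq_of_inj injf; exists I; apply/setP => x.
apply/imsetP/idP => [[r _ ->]|xX].
  by have := fI (s^-1%g r); rewrite permKV => <-; exact: enum_valP.
exists (s (cast_ord cX (enum_rank_in xX x))) => //.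
by rewrite -fI /f cast_ordK enum_rankK_in.
Qed.

Section SpinDiagrams.
Variables (F : fieldType) (io : F) (m d l : nat).
Hypothesis io2 : io * io = -1.

Definition diagram_spin_mx : 'M[F]_(#|{: incr_seq m l}|, #|{: diagram m d}|) :=
  \matrix_(I, c) weight io (val (enum_val c : diagram m d))
                           (chi (occ (val (enum_val I : incr_seq m l)))).

Lemma col_diagram_spin_mx c : col c diagram_spin_mx =
  spin_vec l (fun X => weight io (val (enum_val c : diagram m d)) (chi X)).
Proof. by apply/matrixP => I z; rewrite !mxE. Qed.

Lemma io_neq0 : io != 0.
Proof. by apply: contra_eq_neq io2 => ->; rewrite mul0r eq_sym oppr_eq0 oner_eq0. Qed.

Lemma diagram_spin_mx_inj (v : 'cV[F]_#|{: diagram m d}|) :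
  (2 * l = m - d)%N -> diagram_spin_mx *m v = 0 -> v = 0.
Proof.
move=> hl Fv; apply/eqP; apply: contraT => v0.
have {v0} /existsP[c1 vc1] : [exists c, v c ord0 != 0].
  apply: contraR v0; rewrite negb_exists => /forallP h; apply/eqP/matrixP => c z.
  by rewrite ord1 mxE; apply/eqP; rewrite -[_ == _]negbK; exact: h.
pose dg (c : 'I_#|{: diagram m d}|) : {ffun bdpoint m d -> bdpoint m d} :=
  val (enum_val c : diagram m d).
have bdg c : basis_diagram (dg c) := valP _.
(* A diagram of maximal rank sum in the support of [v] is tested at its own set of last ends. *)
case: (@arg_maxnP _ c1 (fun c => v c ord0 != 0) (fun c => rank_sum (closer (dg c))) vc1).
move=> c vc cmax; have /and3P[pc ncc _] := bdg c.
have [|I IX] := @incr_seq_of_set m l (closers (dg c)).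
  by have := card_closers (bdg c); rewrite -hl; lia.
have chiE := chi_closers (bdg c).
have /matrixP/(_ (enum_rank I) ord0) := Fv; rewrite mxE mxE.
(* Another diagram of the support with nonzero weight there has at least this rank sum, so by
   maximality the same last ends, and is the same diagram. *)
rewrite (bigD1 c) //= big1 ?addr0 => [|c' c'c]; last first.
  apply/eqP; rewrite mxE enum_rankK IX mulf_eq0 -[_ || _]negbK negb_or.
  apply: contra c'c => /andP[w0 vc'].
  have /and3P[pc' ncc' _] := bdg c'.
  have tr x : closer (dg c) x != closer (dg c) (dg c' x).
    by rewrite -!chiE; apply: weight_neq0 w0.
  have [le eq] := rank_sum_closer pc' tr.
  have {}eq : closer (dg c) =1 closer (dg c').
    by apply: eq; apply/eqP; rewrite eqn_leq le; exact: cmax.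
  by apply/eqP/enum_val_inj/val_inj/esym; exact: closer_inj eq.
rewrite mxE enum_rankK IX => /eqP; rewrite mulf_eq0 (negPf vc) orbF => /eqP w0.
suff : weight io (dg c) (chi (closers (dg c))) != 0 by rewrite w0 eqxx.
apply/prodf_neq0 => x _; rewrite /end_weight !chiE closer_pairing //.
by case: (closer _ _) => /=; [case: ifP; rewrite ?io_neq0 ?oner_eq0|rewrite oner_eq0].
Qed.

Lemma diagram_spin_mx_tl (A : F) (i : 'I_m.-1) I c : - A ^+ 2 - A ^- 2 = 0 ->
  (diagram_spin_mx *m tl_mx A d i) I c =
  let E := val (enum_val c : diagram m d) in
  if E (inl (ordL i)) == inl (ordR i) then 0
  else weight io (surgery E (inl (ordL i)) (inl (ordR i)))
              (chi (occ (val (enum_val I : incr_seq m l)))).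
Proof.
move=> A0; pose E := val (enum_val c : diagram m d); rewrite /= -/E.
have bE : basis_diagram E := valP _.
have /and3P[pE ncE _] := bE; rewrite mxE.
have uv : bdrank (inl (ordR i) : bdpoint m d) = (bdrank (inl (ordL i) : bdpoint m d)).+1 by [].
case: eqVneq => [Euv|Euv].
  (* A circle splits off, so a positive power of the zero loop value appears. *)
  apply: big1 => r _; rewrite [X in _ * X]mxE /= -/E A0 expr0n.
  by rewrite gtn_eqF ?stack_loops_gt0 // mulr0n if_same mulr0.
have entry r : tl_mx A d i r c =
    (val (enum_val r : diagram m d) == surgery E (inl (ordL i)) (inl (ordR i)))%:R.
  rewrite mxE /= -/E is_stack_surgery //; last by have /and3P[] := valP (enum_val r : diagram m d).
  by rewrite stack_loops0 // expr0; case: ifP.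
have [bs|bs] := boolP (basis_diagram (surgery E (inl (ordL i)) (inl (ordR i)))).
  pose P : diagram m d := Sub (surgery E (inl (ordL i)) (inl (ordR i))) bs.
  rewrite (bigD1 (enum_rank P)) //= big1 => [|r rP].
    by rewrite entry mxE !enum_rankK eqxx mulr1 addr0.
  rewrite entry (_ : (_ == _) = false) ?mulr0 //.
  by apply: contraNF rP => /eqP e; apply/eqP/enum_val_inj/val_inj; rewrite enum_rankK.
rewrite big1 => [|r _]; last first.
  rewrite entry (_ : (_ == _) = false) ?mulr0 //.
  by apply: contraNF bs => /eqP <-; exact: (valP (enum_val r : diagram m d)).
(* Surgery can leave the basis only by joining two bottom points; both are singled out, so the
   weight vanishes as well. *)
have := bs; rewrite /basis_diagram surgery_pairing // surgery_noncrossing //=.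
rewrite negb_forall => /existsP[j nj]; apply/esym/(@weight_arc_eq0 _ _ _ _ _ _ (inr j)).
by move: nj; case: (surgery _ _ _ _).
Qed.

End SpinDiagrams.

(** * The chain of curves inside the spin chain *)

Section ChainInclusion.
Variables (F : fieldType) (io : F) (N : nat).
Hypothesis io2 : io * io = -1.

Let lo (k : 'I_N) : 'I_N.+1 := widen_ord (leqnSn N) k.
Let hi (k : 'I_N) : 'I_N.+1 := lift ord0 k.

(* Column k is the class c_k of the k-th curve, a multiple of x_k + io x_(k+1);
   the scaling gives c_k and c_(k+1) the mutual coefficients 1 and -1 of the twists. *)
Definition chain_mx : 'M[F]_(N.+1, N) :=
  \matrix_(x, k) ((- io) ^+ k * ((x == lo k)%:R + io * (x == hi k)%:R)).

(** Row [k] is minus the part beyond [k] of the form with coordinates [io ^+ x]. On [c_j] it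
    vanishes for [j < k] by support and for [j > k] because the whole form kills [c_j]; on [c_k] it
    is [1]. *)
Definition chain_retract : 'M[F]_(N, N.+1) :=
  \matrix_(k, x) (- ((k < x)%N%:R * io ^+ x)).

Lemma mulmx_chain a (B : 'M[F]_(a, N.+1)) r k :
  (B *m chain_mx) r k = (- io) ^+ k * (B r (lo k) + io * B r (hi k)).
Proof.
have hl : hi k != lo k by rewrite -val_eqE /= gtn_eqF.
rewrite mxE (bigD1 (lo k)) //= (bigD1 (hi k)) //= big1 => [|x /andP[xl xh]].
  by rewrite !mxE !eqxx (negPf hl) eq_sym (negPf hl) !mulr0n !mulr1n; ring.
by rewrite mxE (negPf xl) (negPf xh) !mulr0n; ring.
Qed.

Lemma expr_io_mul k : (- io) ^+ k * io ^+ k = 1.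
Proof. by rewrite -exprMn mulNr io2 opprK expr1n. Qed.

Lemma chain_retractK : chain_retract *m chain_mx = 1%:M.
Proof.
apply/matrixP => k k'; rewrite mulmx_chain !mxE /= /bump leq0n add1n ltnS.
have -> : (k == k')%:R = (k <= k')%N%:R - (k < k')%N%:R :> F.
  by rewrite -val_eqE; case: ltngtP => _; rewrite ?mulr0n ?mulr1n; ring.
rewrite (_ : _ * _ = ((- io) ^+ k' * io ^+ k') *
    (- (io * io) * (k <= k')%N%:R - (k < k')%N%:R)); last by rewrite exprS; ring.
by rewrite expr_io_mul io2 opprK !mul1r.
Qed.

Lemma sum_lo (f : nat -> F) (x : 'I_N.+1) :
  \sum_(k < N) (x == lo k)%:R * f k = (x < N)%N%:R * f x.
Proof.
have [xN|Nx] := ltnP x N.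
  rewrite (bigD1 (Ordinal xN)) //= -val_eqE /= eqxx big1 ?addr0 // => k kx.
  rewrite -val_eqE /= (_ : (_ == _) = false) ?mul0r //.
  by apply: contraNF kx => /eqP e; apply/eqP/val_inj.
rewrite mul0r big1 // => k _.
by rewrite -val_eqE /= gtn_eqF ?mul0r // (leq_trans (ltn_ord k)).
Qed.

Lemma sum_hi (f : nat -> F) (x : 'I_N.+1) :
  \sum_(k < N) (x == hi k)%:R * f k = (0 < x)%N%:R * f x.-1.
Proof.
case: (unliftP ord0 x) => [k ->|->]; last first.
  by rewrite mul0r big1 // => k _; rewrite -val_eqE /= mul0r.
rewrite (bigD1 k) //= eqxx big1 ?addr0 // => k' k'k.
by rewrite (inj_eq (@lift_inj _ _)) eq_sym (negPf k'k) mul0r.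
Qed.

(** Both sides kill the first basis vector and fix every [c_k]; the proof compares entries. *)
Lemma chain_proj : chain_mx *m chain_retract = proj_mx io N.+1.
Proof.
apply/matrixP => x y; rewrite [LHS]mxE [RHS]mxE.
pose f k := - ((- io) ^+ k * ((k < y)%N%:R * io ^+ y)).
rewrite (eq_bigr (fun k : 'I_N => (x == lo k)%:R * f k + io * ((x == hi k)%:R * f k))).
  rewrite big_split -mulr_sumr /= sum_lo sum_hi.
  have -> : (x < N)%N%:R * f x = f x.
    have [xN|Nx] := ltnP x N; first by rewrite mul1r.
    rewrite /f (_ : (x < y)%N = false) ?mul0r ?mulr0 ?oppr0 //.
    by apply/negbTE; rewrite -leqNgt (leq_trans _ Nx) // -ltnS.
  rewrite -val_eqE /= /f; case: (nat_of_ord x) => [|n] /=.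
    rewrite mul0r mulr0 addr0 expr0 mul1r.
    by case: (nat_of_ord y) => [|k] /=; rewrite ?mulr0n ?mulr1n ?expr0; ring.
  rewrite mul1r mul0r subr0.
  rewrite (_ : (n.+1 == y)%:R = (n < y)%N%:R - (n.+1 < y)%N%:R :> F); last first.
    by case: (ltngtP n.+1 y) => _; rewrite ?mulr0n ?mulr1n; ring.
  have [ny|ny|ny] := ltngtP n.+1 y.
  - by rewrite exprS ?mulr1n ?mulr0n; ring.
  - by rewrite ?mulr1n ?mulr0n; ring.
  - rewrite -ny [io ^+ _]exprS ?mulr1n ?mulr0n.
    rewrite (_ : _ + _ = - (io * io) * ((- io) ^+ n * io ^+ n)); last by ring.
    by rewrite expr_io_mul io2; ring.
by move=> k _; rewrite !mxE /f; ring.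
Qed.

(** For the cup vector [w] at [i], [c_i = (- io)^i w], and [w^T c_k] is [(- io)^i] times the
    coefficient of the twist, so the same scalar occurs on both sides. *)
Lemma spin_mx_chain (i : 'I_N.+1.-1) :
  spin_mx io i *m chain_mx = chain_mx *m twist_mx F N i.
Proof.
rewrite /spin_mx /twist_mx mulmxDl mulmxDr mul1mx mulmx1; congr (_ + _).
rewrite mulmxA -mulmxA.
have iN : (i < N)%N := ltn_ord i.
have -> : chain_mx *m twist_dir F N i = (- io) ^+ i *: cup_col io i.
  apply/matrixP => x z; rewrite mxE (bigD1 (Ordinal iN)) //= big1 => [|k ki].
    rewrite !mxE eqxx mulr1n mulr1 addr0 -!val_eqE /=.
    by rewrite /bump leq0n add1n.
  rewrite [X in _ * X]mxE (_ : (_ == _) = false) ?mulr0 //.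
  by apply: contraNF ki => /eqP e; apply/eqP/val_inj.
have -> : (cup_col io i)^T *m chain_mx = (- io) ^+ i *: twist_form F N i.
  apply/matrixP => z k; rewrite mulmx_chain !mxE -!val_eqE /= /bump leq0n add1n eqSS.
  have [ki|ik|e] := ltngtP (k : nat) i.
  - rewrite (_ : (k == i.+1 :> nat) = false); last by clear -ki; lia.
    have [kS|kS] := eqVneq k.+1 (i : nat); rewrite ?mulr0n ?mulr1n; last by ring.
    by rewrite -kS exprS; ring.
  - rewrite (_ : (k.+1 == i) = false); last by clear -ik; lia.
    have [kS|kS] := eqVneq (k : nat) i.+1; rewrite ?mulr0n ?mulr1n; last by ring.
    rewrite kS exprS (_ : _ * _ = - (io * io) * (- io) ^+ i); last by ring.
    by rewrite io2; ring.
  - rewrite (_ : (k.+1 == i) = false); last by clear -e; lia.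
    rewrite (_ : (k == i.+1 :> nat) = false); last by clear -e; lia.
    rewrite ?mulr0n ?mulr1n (_ : _ * _ = (- io) ^+ k * (1 + io * io)); last by ring.
    by rewrite io2 subrr; ring.
by rewrite -scalemxAr -scalemxAl.
Qed.

End ChainInclusion.

(** * Descent of relations along an injective intertwiner, and the embedding of the diagram
    representation *)

Lemma left_inverse_of_inj (F : fieldType) a b (C : 'M[F]_(a, b)) :
  (forall v : 'cV_b, C *m v = 0 -> v = 0) -> exists L, L *m C = 1%:M.
Proof.
move=> injC; have /row_freeP[B CB] : row_free C^T.
  apply: inj_row_free => v vC; apply: trmx_inj; rewrite trmx0; apply: injC.
  by rewrite -[C]trmxK -trmx_mul vC trmx0.
by exists B^T; rewrite -[C]trmxK -trmx_mul CB trmx1.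
Qed.

Section Restriction.
Variables (F : fieldType) (m a b : nat) (C : 'M[F]_(a, b)) (L : 'M[F]_(b, a)).
Variables (X : 'I_m.-1 -> 'M[F]_b) (Y : 'I_m.-1 -> 'M[F]_a).
Hypothesis LC : L *m C = 1%:M.
Hypothesis CX : forall i, C *m X i = Y i *m C.

Let cancelC (M M' : 'M_b) : C *m M = C *m M' -> M = M'.
Proof. by move=> /(congr1 (mulmx L)); rewrite !mulmxA LC !mul1mx. Qed.

Let C2 i j : C *m (X i *m X j) = Y i *m Y j *m C.
Proof. by rewrite mulmxA CX -mulmxA CX mulmxA. Qed.

Lemma restriction_unit : (forall i, Y i \in unitmx) -> forall i, X i \in unitmx.
Proof.
move=> unitY i; have : (L *m invmx (Y i) *m C) *m X i = 1%:M.
  by rewrite -!mulmxA CX (mulmxA (invmx _)) mulVmx // mul1mx.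
by move=> /mulmx1_unit[].
Qed.

Lemma restriction_far :
  (forall i j : 'I_m.-1, (i.+1 < j)%N -> Y i *m Y j = Y j *m Y i) ->
  forall i j : 'I_m.-1, (i.+1 < j)%N -> X i *m X j = X j *m X i.
Proof. by move=> farY i j ij; apply: cancelC; rewrite !C2 farY. Qed.

Lemma restriction_braid :
  (forall i j : 'I_m.-1, j = i.+1 :> nat -> Y i *m Y j *m Y i = Y j *m Y i *m Y j) ->
  forall i j : 'I_m.-1, j = i.+1 :> nat -> X i *m X j *m X i = X j *m X i *m X j.
Proof.
move=> braidY i j ij; apply: cancelC; rewrite [LHS]mulmxA [RHS]mulmxA !C2.
by rewrite -(mulmxA _ C (X i)) -(mulmxA _ C (X j)) !CX !mulmxA braidY.
Qed.

End Restriction.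

Lemma diagram_rep_embedding (F : fieldType) (io A : F) (m N d l : nat) :
  N.+1 = m -> (2 * l = m - d)%N -> io * io = -1 -> A != 0 -> A^-1 * A^-1 = io ->
  - A ^+ 2 - A ^- 2 = 0 ->
  exists (eta : braid_group m -> 'M[F]_#|{: diagram m d}|)
         (rho : braid_group m -> 'M[F]_#|{: incr_seq N l}|)
         (C : 'M[F]_(#|{: incr_seq N l}|, #|{: diagram m d}|)),
    [/\ is_rep eta, (forall i, eta (sigma i) = A^-1 *: eta_gen A d i), is_rep rho,
        (forall i, rho (sigma i) = ext_mx l (twist_mx F N i))
      & (forall v : 'cV_ _, C *m v = 0 -> v = 0) /\
        forall x, C *m eta x = rho x *m C].
Proof.
move=> Nm hl io2 A0 AA Aloop; subst m.
pose Y (i : 'I_N.+1.-1) := ext_mx l (twist_mx F N i).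
pose X (i : 'I_N.+1.-1) := A^-1 *: eta_gen A d i.
pose Fs : 'M[F]_(_, _) := diagram_spin_mx io N.+1 d l.
pose C := ext_mx l (chain_retract io N) *m Fs.
have XE i : X i = 1%:M + io *: tl_mx A d i.
  by rewrite /X /eta_gen scalerDr scale_scalar_mx mulVf // scalerA AA.
have entry B (I : 'I_#|{: incr_seq N.+1 l}|) c :
    (ext_mx l B *m Fs) I c =
    (ext_mx l B *m spin_vec l (fun Z => weight io (val (enum_val c : diagram N.+1 d))
      (chi Z))) (enum_rank (enum_val I)) ord0.
  rewrite -col_diagram_spin_mx enum_valK mxE [RHS]mxE; apply: eq_bigr => k _.
  by rewrite [X in _ = _ * X]mxE.
have spinX i : ext_mx l (spin_mx io i) *m Fs = Fs *m X i.
  apply/matrixP => I c; have /and3P[pE ncE _] := valP (enum_val c : diagram N.+1 d).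
  rewrite entry ext_spin_mx_weight // XE mulmxDr mulmx1 -scalemxAr.
  by rewrite [RHS]mxE [X in _ = _ + X]mxE /Fs diagram_spin_mx_tl // [X in _ = X + _]mxE.
have projF : ext_mx l (proj_mx io N.+1) *m Fs = Fs.
  apply/matrixP => I c; have /and3P[pE ncE _] := valP (enum_val c : diagram N.+1 d).
  by rewrite entry ext_proj_mx_weight // [RHS]mxE.
(* The projection fixes the diagram vectors, so [C] holds their coordinates in the curve classes. *)
have JC : ext_mx l (chain_mx io N) *m C = Fs.
  by rewrite mulmxA -ext_mxM chain_proj.
have CX i : C *m X i = Y i *m C.
  have e : Fs *m X i = ext_mx l (chain_mx io N) *m (Y i *m C).
    by rewrite -spinX -{1}JC !mulmxA -!ext_mxM spin_mx_chain.
  by rewrite {1}/C -mulmxA e mulmxA -ext_mxM chain_retractK // ext_mx1 mul1mx.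
have injC (v : 'cV_ _) : C *m v = 0 -> v = 0.
  move=> Cv; apply: (diagram_spin_mx_inj io2 hl).
  by rewrite -/Fs -JC -mulmxA Cv mulmx0.
clearbody C; have [L LC] := left_inverse_of_inj injC.
have unitY i : Y i \in unitmx by apply: ext_twist_unit; exact: ltn_ord.
have farY (i j : 'I_N.+1.-1) : (i.+1 < j)%N -> Y i *m Y j = Y j *m Y i.
  by move=> ij; rewrite -!ext_mxM twist_mx_far //; exact: ltn_ord.
have braidY (i j : 'I_N.+1.-1) : j = i.+1 :> nat ->
    Y i *m Y j *m Y i = Y j *m Y i *m Y j.
  by move=> ij; have := ltn_ord j; rewrite /Y -!ext_mxM ij => ?; rewrite twist_mx_braid.
have unitX := restriction_unit LC CX unitY.
have farX := restriction_far LC CX farY.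
have braidX := restriction_braid LC CX braidY.
exists (braid_rep_of X), (braid_rep_of Y), C; split.
- exact: braid_rep_of_is_rep.
- exact: braid_rep_of_sigma.
- exact: braid_rep_of_is_rep.
- exact: braid_rep_of_sigma.
- by split=> // x; exact: intertwine_word.
Qed.

From mathcomp Require Import all_classical all_reals all_analysis.
Require Import Defs.

Import numFieldNormedType.Exports.

Local Open Scope classical_set_scope.
Local Open Scope ring_scope.
Local Open Scope complex_scope.

(** * Singular boundaries *)

Section Boundaries.
Variables (R : realType) (S : topologicalType).

Definition is_boundary k (b : chain R S k) :=
  exists2 c : chain R S k.+1, is_chain c & forall u, b u = boundary c u.

(** Boundaries of different chains can be added only over a common index set; terms outside the
    support vanish. *)
Lemma boundary_widen k (c : chain R S k.+1) (X : set (std_simplex R k.+1 -> S)) u :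
  [set s | c s != 0] `<=` X ->
  boundary c u = \sum_(s \in X)
    c s * \sum_(i < k.+2) (-1) ^+ i * simplex_chain (s \o face i) u.
Proof.
move=> cX; rewrite /boundary [RHS]fsbig_mkcond; apply: eq_fsbigr => s _.
rewrite /patch; case: ifPn => // sX.
have [->|cs] := eqVneq (c s) 0; first by rewrite mul0r.
by move: sX; rewrite mem_set //; exact: cX.
Qed.

Lemma is_boundary_lin k (a : R[i]) (b1 b2 : chain R S k) :
  is_boundary b1 -> is_boundary b2 ->
  is_boundary (fun u => a * b1 u + b2 u).
Proof.
move=> [c1 [f1 s1] e1] [c2 [f2 s2] e2]; exists (fun s => a * c1 s + c2 s).
  split.
    apply: (@sub_finite_set _ _ ([set s | c1 s != 0] `|` [set s | c2 s != 0])).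
      move=> s /=; apply: contra_neqP => /not_orP[/negP/negPn/eqP -> /negP/negPn/eqP ->].
      by rewrite mulr0 addr0.
    by rewrite finite_setU.
  move=> s; have [z1|/s1 //] := eqVneq (c1 s) 0.
  by rewrite z1 mulr0 add0r; exact: s2.
have finX : finite_set ([set s | c1 s != 0] `|` [set s | c2 s != 0]).
  by rewrite finite_setU.
move=> u; rewrite e1 e2 !(@boundary_widen _ _ ([set s | c1 s != 0] `|` [set s | c2 s != 0])) //.
- rewrite mulr_fsumr -fsbig_split //=; apply: eq_fsbigr => s _.
  by rewrite mulrDl mulrA.
- move=> s /=; apply: contra_neqP => /not_orP[/negP/negPn/eqP -> /negP/negPn/eqP ->].
  by rewrite mulr0 addr0.
Qed.

Lemma eq_is_boundary k (b1 b2 : chain R S k) :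
  (forall u, b1 u = b2 u) -> is_boundary b1 -> is_boundary b2.
Proof. by move=> e [c hc ec]; exists c => // u; rewrite -e. Qed.

Lemma is_boundary_simplex k (s : std_simplex R k.+1 -> S) : continuous s ->
  is_boundary (fun u => \sum_(i < k.+2) (-1) ^+ i * simplex_chain (s \o face i) u).
Proof.
move=> cs; have supp : [set t | simplex_chain s t != 0] `<=` [set s].
  move=> t /=; rewrite /simplex_chain; case: asboolP => // _.
  by rewrite eqxx.
exists (simplex_chain s).
  split; first exact: sub_finite_set supp (finite_set1 _).
  by move=> t /supp ->.
move=> u; rewrite (boundary_widen u supp) fsbig_set1 /simplex_chain; case: asboolP => // _.
by rewrite mul1r.
Qed.

End Boundaries.

(** * Affine simplices in the strip *)

Section Segments.
Variables (R : realType) (S : topologicalType).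
Implicit Types (F : R * R -> S) (P Q T : R * R).

Definition segment F P Q : std_simplex R 1 -> S := fun u =>
  F (set_val u ord0 ord0 * P.1 + set_val u ord0 ord_max * Q.1,
     set_val u ord0 ord0 * P.2 + set_val u ord0 ord_max * Q.2).

Definition triangle F P Q T : std_simplex R 2 -> S := fun u =>
  let x := set_val u ord0 in
  let x0 := x ord0 in let x1 := x (lift ord0 ord0) in let x2 := x ord_max in
  F (x0 * P.1 + x1 * Q.1 + x2 * T.1, x0 * P.2 + x1 * Q.2 + x2 * T.2).

Lemma simplex1E (u : std_simplex R 1) :
  [/\ 0 <= set_val u ord0 ord0, 0 <= set_val u ord0 ord_max
    & set_val u ord0 ord0 = 1 - set_val u ord0 ord_max].
Proof.
have [u0 u1] := set_valP u; split=> //.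
rewrite -u1 !big_ord_recl big_ord0 addr0.
have -> : lift ord0 ord0 = ord_max :> 'I_2 by exact: val_inj.
by rewrite addrK.
Qed.

Lemma continuous_set_val_coord k (i : 'I_k.+1) :
  continuous (fun u : std_simplex R k => set_val u ord0 i).
Proof.
move=> u; apply: (@continuous_comp _ _ _ set_val (fun x : 'rV[R]_k.+1 => x ord0 i)).
  exact: initial_continuous.
exact: coord_continuous.
Qed.

Lemma continuous_lincomb3 (X : topologicalType) (f g h : X -> R) p q t :
  continuous f -> continuous g -> continuous h ->
  continuous (fun v => f v * p + g v * q + h v * t).
Proof.
move=> cf cg ch v.
apply: cvgD; [apply: cvgD|]; apply: cvgM;
  by [exact: cvg_cst | exact: cf | exact: cg | exact: ch].
Qed.

(** The strip is convex, so the affine triangle stays where [F] is known to be continuous. *)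
Lemma continuous_triangle F P Q T : {within @strip R, continuous F} ->
  strip P -> strip Q -> strip T -> continuous (triangle F P Q T).
Proof.
move=> /subspace_continuousP cF sP sQ sT u.
pose L (v : std_simplex R 2) : R * R :=
  let x := set_val v ord0 in
  let x0 := x ord0 in let x1 := x (lift ord0 ord0) in let x2 := x ord_max in
  (x0 * P.1 + x1 * Q.1 + x2 * T.1, x0 * P.2 + x1 * Q.2 + x2 * T.2).
have convex (x y z p q t : R) : 0 <= x -> 0 <= y -> 0 <= z -> x + (y + z) = 1 ->
    0 <= p <= 1 -> 0 <= q <= 1 -> 0 <= t <= 1 ->
    0 <= x * p + y * q + z * t <= 1.
  move=> x0 y0 z0 e /andP[p0 p1] /andP[q0 q1] /andP[t0 t1].
  by apply/andP; split; nra.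
have Lstrip v : strip (L v).
  have [v0 v1] := set_valP v; apply: convex => //; rewrite -v1.
  rewrite !big_ord_recl big_ord0 addr0.
  by have -> : lift ord0 (lift ord0 ord0) = ord_max :> 'I_3 by exact: val_inj.
have cC p q t := @continuous_lincomb3 (std_simplex R 2) _ _ _ p q t
  (@continuous_set_val_coord 2 ord0) (@continuous_set_val_coord 2 (lift ord0 ord0))
  (@continuous_set_val_coord 2 ord_max).
have cL : L v @[v --> u] --> L u.
  by apply: (@cvg_pair _ _ _ (nbhs u) (nbhs (L u).1) (nbhs (L u).2)
    _ _ _ (fun v => (L v).1) (fun v => (L v).2)); exact: cC.
move=> U /= nU; have := cF _ (Lstrip u) U nU.
move=> /cL; rewrite /= !nbhs_simpl /=; apply: filterS => v /=; apply.
exact: Lstrip.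
Qed.

Lemma is_boundary_triangle F P Q T : {within @strip R, continuous F} ->
  strip P -> strip Q -> strip T ->
  is_boundary (fun u => simplex_chain (segment F Q T) u
    - simplex_chain (segment F P T) u + simplex_chain (segment F P Q) u : R[i]).
Proof.
move=> cF sP sQ sT; have := is_boundary_simplex (continuous_triangle cF sP sQ sT).
apply: eq_is_boundary => u; rewrite !big_ord_recl big_ord0 /= addr0.
rewrite expr0 mul1r expr1 mulN1r [(-1) ^+ _]expr2 mulrNN !mul1r addrA.
have faceE (i : 'I_3) (v : std_simplex R 1) :
    set_val (face i v) = face_row i (set_val v) by [].
have l12 : lift ord0 (lift ord0 ord0) = ord_max :> 'I_3 by exact: val_inj.
have u0 : unlift (ord0 : 'I_3) ord0 = None by rewrite unlift_none.
congr (_ - _ + _); congr simplex_chain; apply/funext => v;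
  rewrite /segment /triangle /= faceE !mxE.
- have -> : unlift (ord0 : 'I_3) ord0 = None by rewrite unlift_none.
  rewrite liftK; have -> : ord_max = lift ord0 (ord_max : 'I_2) by exact: val_inj.
  by rewrite liftK; rewrite !mul0r !add0r.
- rewrite unlift_none.
  have -> : ord0 = lift (lift ord0 ord0 : 'I_3) (ord0 : 'I_2) by exact: val_inj.
  have -> : ord_max = lift (lift ord0 ord0 : 'I_3) (ord_max : 'I_2) by exact: val_inj.
  by rewrite !liftK !mul0r !addr0.
- rewrite l12 unlift_none.
  have -> : lift ord0 ord0 = lift (ord_max : 'I_3) (ord_max : 'I_2) by exact: val_inj.
  have -> : ord0 = lift (ord_max : 'I_3) (ord0 : 'I_2) by exact: val_inj.
  by rewrite !liftK !mul0r !addr0.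
Qed.

End Segments.

(** * Homology classes of twisted curves *)

Section Twists.
Variables (R : realType) (S : topologicalType).
Implicit Types (a b : R * R -> S) (f : S -> S).

Local Notation sc := simplex_chain.

Lemma eq_segment (F G : R * R -> S) (P Q P' Q' : R * R) :
  (forall s : R, 0 <= s <= 1 ->
     F ((1 - s) * P.1 + s * Q.1, (1 - s) * P.2 + s * Q.2) =
     G ((1 - s) * P'.1 + s * Q'.1, (1 - s) * P'.2 + s * Q'.2)) ->
  segment F P Q = segment G P' Q'.
Proof.
move=> e; apply/funext => u; rewrite /segment.
by have [u0 u1 eu] := simplex1E u; rewrite eu in u0 *; apply: e; lra.
Qed.

Lemma core_segment a : core a = segment a (0, 2^-1) (1, 2^-1).
Proof.
apply/funext => u; rewrite /core /segment /=; congr (a (_, _)).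
  by rewrite mulr0 add0r mulr1.
by have [_ _ ->] := simplex1E u; ring.
Qed.

(** The parallelogram between the two loops is cut into two triangles along a diagonal; its slanted
    sides agree by periodicity. *)
Lemma loop_segment a (x t : R) : annulus a -> 0 <= t <= 1 ->
  is_boundary (fun u => sc (segment a (x, t) (x + 1, t)) u - sc (core a) u : R[i]).
Proof.
move=> [ca pa _] t01; have h01 : 0 <= (2^-1 : R) <= 1 by lra.
have b1 := @is_boundary_triangle R S a (0, 2^-1) (x, t) (x + 1, t) ca h01 t01 t01.
have b2 := @is_boundary_triangle R S a (0, 2^-1) (1, 2^-1) (x + 1, t) ca h01 h01 t01.
have e : segment a (1, 2^-1) (x + 1, t) = segment a (0, 2^-1) (x, t).
  apply: eq_segment => s /andP[s0 s1] /=; rewrite -[RHS]pa; last by move: t01 => /andP[]; nra.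
  by congr (a (_, _)); ring.
apply: eq_is_boundary (is_boundary_lin (-1) b2 b1) => u; rewrite e core_segment.
ring.
Qed.

Lemma continuous_strip_comp a f : {within @strip R, continuous a} -> continuous f ->
  {within @strip R, continuous (f \o a)}.
Proof. by move=> ca cf; apply: within_continuous_comp ca => x _; exact: cf. Qed.

(** The twist is the identity on the circle [t = 0] and off the annulus, and a full turn on
    [t = 1]. *)
Lemma twist_fix a f p : annulus a -> right_Dehn_twist a f ->
  (forall x t : R, 0 <= t <= 1 -> p = a (x, t) -> t = 0 \/ t = 1) -> f p = p.
Proof.
move=> [_ pa _] [_ fa fo] h.
have [[y [s [s01 e]]]|ne] := pselect (exists y s : R, 0 <= s <= 1 /\ p = a (y, s)).
  rewrite e fa //; have [->|->] := h _ _ s01 e; first by rewrite addr0.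
  by rewrite pa // ler01 lexx.
by apply: fo => y s s01 e; apply: ne; exists y, s.
Qed.

Lemma twist_self a f : annulus a -> right_Dehn_twist a f ->
  is_boundary (fun u => sc (f \o core a) u - sc (core a) u : R[i]).
Proof.
move=> ha [_ fa _]; have h01 : 0 <= (2^-1 : R) <= 1 by lra.
(* At height [1/2] the twist turns the core by half a period. *)
have -> : f \o core a = segment a (2^-1, 2^-1) (2^-1 + 1, 2^-1).
  rewrite core_segment; apply/funext => u; rewrite /segment /=.
  have [u0 u1 ->] := simplex1E u; rewrite -mulrDl subrK mul1r fa //.
  by congr (a (_, _)); field.
exact: loop_segment.
Qed.

Lemma intr_eq0 (p : int) (x : R) : x = p%:~R -> -1 < x < 1 -> p = 0.
Proof.
move=> ->; rewrite -[X in _ < _ < X](mulr1z (1 : R)) -[-1](mulrN1z (1 : R)) !ltr_int.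
by clear; lia.
Qed.

Lemma intr_eq01 (p : int) (x : R) : x = p%:~R -> -1 < x < 2 -> p = 0 \/ p = 1.
Proof.
move=> ->; rewrite -[2]/(2%:~R) -[-1](mulrN1z (1 : R)) !ltr_int.
by clear; lia.
Qed.

(** The core of [b] crosses [a] for [y] between [1/2] and [3/4], along [x = 1/8] upwards. The twist
    slants this piece to end at [9/8]; the triangle [ta] shows the gain to be a loop at height [1],
    that is, the core of [a]. *)
Lemma twist_next a b f : annulus a -> annulus b -> plumbed a b ->
  right_Dehn_twist a f ->
  is_boundary (fun u => sc (f \o core b) u - sc (core b) u - sc (core a) u : R[i]).
Proof.
move=> ha hb ab hf; have [ca pa _] := ha; have [cb pb _] := hb; have [cf fa fo] := hf.
have h01 : 0 <= (2^-1 : R) <= 1 by lra.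
have h0 : 0 <= (0 : R) <= 1 by lra.
have h1 : 0 <= (1 : R) <= 1 by lra.
have cF := continuous_strip_comp cb cf.
have tF1 := @is_boundary_triangle R S _ (0, 2^-1) (2^-1, 2^-1) (3 / 4, 2^-1) cF h01 h01 h01.
have tF2 := @is_boundary_triangle R S _ (0, 2^-1) (3 / 4, 2^-1) (1, 2^-1) cF h01 h01 h01.
have tb1 := @is_boundary_triangle R S _ (0, 2^-1) (2^-1, 2^-1) (3 / 4, 2^-1) cb h01 h01 h01.
have tb2 := @is_boundary_triangle R S _ (0, 2^-1) (3 / 4, 2^-1) (1, 2^-1) cb h01 h01 h01.
have ta := @is_boundary_triangle R S _ (8^-1, 0) (8^-1, 1) (8^-1 + 1, 1) ca h0 h1 h1.
have la := loop_segment 8^-1 ha h1.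
have cross s : 0 <= s <= 1 -> b (2^-1 + s / 4, 2^-1) = a (8^-1, s).
  move=> s01; apply/esym; apply/(ab _ _ _ _ s01 h01).
  by split; exists 0; rewrite addr0 //; field.
have fixl y : 0 <= y <= 2^-1 \/ 3 / 4 <= y <= 1 -> f (b (y, 2^-1)) = b (y, 2^-1).
  move=> hy; apply: (twist_fix ha hf) => x t t01 /esym/(ab _ _ _ _ t01 h01).
  move=> [_ [q yq]]; have eq1 : y - 2^-1 - t / 4 = q%:~R by rewrite yq; ring.
  have q0 : q = 0 by apply: intr_eq0 eq1 _; case: hy; lra.
  by rewrite q0 mulr0z in yq; case: hy => hy; [left | right]; lra.
have e1 : segment (f \o b) (0, 2^-1) (2^-1, 2^-1) = segment b (0, 2^-1) (2^-1, 2^-1).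
  apply: eq_segment => s s01 /=; rewrite -mulrDl subrK mul1r; apply: fixl; left; lra.
have e2 : segment (f \o b) (3 / 4, 2^-1) (1, 2^-1) = segment b (3 / 4, 2^-1) (1, 2^-1).
  apply: eq_segment => s s01 /=; rewrite -mulrDl subrK mul1r; apply: fixl; right; lra.
have e3 : segment b (2^-1, 2^-1) (3 / 4, 2^-1) = segment a (8^-1, 0) (8^-1, 1).
  apply: eq_segment => s s01 /=; rewrite -mulrDl subrK mul1r.
  have -> : (1 - s) / 2 + s * (3 / 4) = 2^-1 + s / 4 by field.
  by rewrite cross //; congr (a (_, _)); ring.
have e4 : segment (f \o b) (2^-1, 2^-1) (3 / 4, 2^-1) = segment a (8^-1, 0) (8^-1 + 1, 1).
  apply: eq_segment => s s01 /=; rewrite -mulrDl subrK mul1r.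
  have -> : (1 - s) / 2 + s * (3 / 4) = 2^-1 + s / 4 by field.
  by rewrite cross // fa //; congr (a (_, _)); ring.
have eF : f \o core b = segment (f \o b) (0, 2^-1) (1, 2^-1) by rewrite core_segment.
rewrite eF (core_segment b); move: tF1 tF2 tb1 tb2; rewrite e1 e2 e3 e4 => tF1 tF2 tb1 tb2.
have B1 := is_boundary_lin (-1) tF1 tb1.
have B2 := is_boundary_lin (-1) tF2 tb2.
have B3 := is_boundary_lin (-1) ta la.
apply: eq_is_boundary (is_boundary_lin 1 B1 (is_boundary_lin 1 B2 B3)) => u.
ring.
Qed.

(** The core of [a] crosses [b] for [x] between [0] and [1/4], along [y = 5/8] downwards. The
    twisted piece starts at [13/8] instead, and the triangle [tb] shows the loss of one loop at
    height [1]. *)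
Lemma twist_prev a b f : annulus a -> annulus b -> plumbed a b ->
  right_Dehn_twist b f ->
  is_boundary (fun u => sc (f \o core a) u - sc (core a) u + sc (core b) u : R[i]).
Proof.
move=> ha hb ab hf; have [ca pa _] := ha; have [cb pb _] := hb; have [cf fb fo] := hf.
have h01 : 0 <= (2^-1 : R) <= 1 by lra.
have h0 : 0 <= (0 : R) <= 1 by lra.
have h1 : 0 <= (1 : R) <= 1 by lra.
have cF := continuous_strip_comp ca cf.
have tF := @is_boundary_triangle R S _ (0, 2^-1) (4^-1, 2^-1) (1, 2^-1) cF h01 h01 h01.
have ta := @is_boundary_triangle R S _ (0, 2^-1) (4^-1, 2^-1) (1, 2^-1) ca h01 h01 h01.
have tb := @is_boundary_triangle R S _ (5 / 8, 1) (5 / 8 + 1, 1) (5 / 8, 0) cb h1 h1 h0.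
have lb := loop_segment (5 / 8) hb h1.
have cross s : 0 <= s <= 1 -> a (s / 4, 2^-1) = b (5 / 8, 1 - s).
  move=> s01; have s01' : 0 <= 1 - s <= 1 by lra.
  apply/(ab _ _ _ _ h01 s01').
  by split; exists 0; rewrite addr0 //; field.
have fixl x : 4^-1 <= x <= 1 -> f (a (x, 2^-1)) = a (x, 2^-1).
  move=> hx; apply: (twist_fix hb hf) => y s s01 /(ab _ _ _ _ h01 s01).
  move=> [[p xp] _]; have eq1 : x - (1 - s) / 4 = p%:~R by rewrite xp; ring.
  (* The value [p = 1] occurs at [x = 1], where the core closes up and [s = 1]. *)
  have p01 : p = 0 \/ p = 1 by apply: intr_eq01 eq1 _; lra.
  by case: p01 xp => ->; rewrite ?mulr0z ?mulr1z => xp; [left | right]; lra.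
have e1 : segment (f \o a) (4^-1, 2^-1) (1, 2^-1) = segment a (4^-1, 2^-1) (1, 2^-1).
  apply: eq_segment => s s01 /=; rewrite -mulrDl subrK mul1r; apply: fixl; lra.
have e2 : segment a (0, 2^-1) (4^-1, 2^-1) = segment b (5 / 8, 1) (5 / 8, 0).
  apply: eq_segment => s s01 /=; rewrite -mulrDl subrK mul1r mulr0 add0r cross //.
  by congr (b (_, _)); ring.
have e3 : segment (f \o a) (0, 2^-1) (4^-1, 2^-1) = segment b (5 / 8 + 1, 1) (5 / 8, 0).
  apply: eq_segment => s s01 /=; rewrite -mulrDl subrK mul1r mulr0 add0r cross //.
  by rewrite fb; [congr (b (_, _)); ring | lra].
have eF : f \o core a = segment (f \o a) (0, 2^-1) (1, 2^-1) by rewrite core_segment.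
rewrite eF (core_segment a); move: tF ta; rewrite e1 e2 e3 => tF ta.
have B1 := is_boundary_lin (-1) tF ta.
have B2 := is_boundary_lin (-1) lb tb.
apply: eq_is_boundary (is_boundary_lin 1 B1 B2) => u.
ring.
Qed.

End Twists.

Lemma curve_chain_H1_matrix (R : realType) (S : topologicalType) N
    (a : 'I_N -> R * R -> S) (f : S -> S) (j : 'I_N) :
  curve_chain a -> right_Dehn_twist (a j) f ->
  H1_matrix (fun k => core (a k)) f (twist_mx R[i] N j).
Proof.
move=> [_ ha _ cons far _] hf k.
pose c : R[i] := (k == j.+1 :> nat)%:R - (k.+1 == j)%:R.
suff [b hb eb] : is_boundary (fun u => simplex_chain (f \o core (a k)) u -
    (simplex_chain (core (a k)) u + c * simplex_chain (core (a j)) u) : R[i]).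
  exists b; split=> // u; rewrite -eb; congr (_ - _).
  rewrite /lincomb_chain.
  under eq_bigr => i _ do rewrite !mxE big_ord1 !mxE mulrDl -mulrA.
  rewrite big_split /= (bigD1 k) //= eqxx mul1r big1 => [|i /negPf ->]; last by rewrite mul0r.
  rewrite addr0; congr (_ + _); rewrite (bigD1 j) //= eqxx mul1r big1 ?addr0 // => i ij.
  by rewrite val_eqE (negPf ij) mul0r.
have self := twist_self (ha j) hf.
have [jk|kj|jk] := ltngtP j k.
- have [kS|kS] := eqVneq (k : nat) j.+1.
    apply: eq_is_boundary (twist_next (ha j) (ha k) (cons _ _ kS) hf) => u.
    rewrite /c kS eqxx; have -> : (j.+2 == j) = false by clear; lia.
    rewrite ?mulr1n ?mulr0n; ring.
  have jk2 : (j.+1 < k)%N by clear -jk kS; lia.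
  have -> : f \o core (a k) = core (a k).
    apply/funext => u /=; have [_ _ fo] := hf; apply: fo => x t t01 e.
    by apply: (far _ _ jk2 _ _ _ _ t01 _ (esym e)); lra.
  (* The zero chain is a boundary, obtained here as a boundary minus itself. *)
  apply: eq_is_boundary (is_boundary_lin (-1) self self) => u.
  rewrite /c (negPf kS); have -> : (k.+1 == j) = false by clear -jk; lia.
  rewrite ?mulr1n ?mulr0n; ring.
- have [kS|kS] := eqVneq (j : nat) k.+1.
    apply: eq_is_boundary (twist_prev (ha k) (ha j) (cons _ _ kS) hf) => u.
    rewrite /c kS eqxx; have -> : (k == k.+2 :> nat) = false by clear; lia.
    rewrite ?mulr1n ?mulr0n; ring.
  have jk2 : (k.+1 < j)%N by clear -kj kS; lia.
  have -> : f \o core (a k) = core (a k).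
    apply/funext => u /=; have [_ _ fo] := hf; apply: fo => x t t01 e.
    by apply: (far _ _ jk2 _ _ _ _ _ t01 e); lra.
  apply: eq_is_boundary (is_boundary_lin (-1) self self) => u.
  rewrite /c; have -> : (k == j.+1 :> nat) = false by clear -kj; lia.
  rewrite eq_sym (negPf kS).
  rewrite ?mulr1n ?mulr0n; ring.
- have -> : k = j by exact/val_inj/esym.
  apply: eq_is_boundary self => u; rewrite /c -jk.
  have [-> ->] : (j == j.+1 :> nat) = false /\ (j.+1 == j) = false by clear; lia.
  rewrite ?mulr1n ?mulr0n; ring.
Qed.

(** * From matrices to subrepresentations, and the value of [A] *)

Lemma equiv_to_subrep_mx (G : groupType) (F : fieldType) k1 k2
    (eta : G -> 'M[F]_k1) (rho : G -> 'M[F]_k2) (C : 'M[F]_(k2, k1)) :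
  (forall v : 'cV_k1, C *m v = 0 -> v = 0) ->
  (forall x, C *m eta x = rho x *m C) -> equiv_to_subrep eta rho.
Proof.
move=> injC CE; pose f : {linear 'cV[F]_k1 -> 'cV[F]_k2} := mulmx C.
have imP w : (w \in limg (linfun f)) <-> exists v, w = f v.
  split=> [/memv_imgP[v _ ->]|[v ->]]; first by exists v; rewrite lfunE.
  by rewrite -[f v]lfunE memv_img ?memvf.
exists (limg (linfun f)); split.
  move=> x w /imP[v ->]; apply/imP; exists (eta x *m v).
  by rewrite /f /= !mulmxA CE.
exists f; split=> // [u v e|x v]; last by rewrite /f /= !mulmxA CE.
apply/eqP; rewrite -subr_eq0; apply/eqP/injC; rewrite mulmxBr.
by apply/eqP; rewrite subr_eq0; apply/eqP.
Qed.

Theorem theorem1p3 (R : realType) (n d g l : nat)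
    (hn : (1 <= n)%N) (hd : ~~ odd d) (hdn : (d <= 2 * n)%N)
    (hg : g = n.-1) (hl : (2 * l = 2 * n - d)%N)
    (S : topologicalType) (a : 'I_(2 * g).+1 -> R * R -> S)
    (hS : curve_chain a)
    (t : 'I_(2 * g).+1 -> S -> S)
    (ht : forall j, right_Dehn_twist (a j) (t j)) :
  let A : R[i] := expi (- (pi / 4)) in
  exists (eta : braid_group (2 * n) -> 'M[R[i]]_#|{: diagram (2 * n) d}|)
         (rho : braid_group (2 * n) -> 'M[R[i]]_#|{: incr_seq (2 * g).+1 l}|),
    [/\ is_rep eta,
        (forall i, eta (sigma i) = A^-1 *: eta_gen A d i),
        is_rep rho,
        (forall (i : 'I_(2 * n).-1) (j : 'I_(2 * g).+1), i = j :> nat ->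
           exists2 M, H1_matrix (fun k => core (a k)) (t j) M
                    & is_ext_power M (rho (sigma i)))
      & equiv_to_subrep eta rho].
Proof.
move=> A.
(* The double angle formulas reduce [exp(- pi i / 2)] to the known values of [cos] and [sin] at
   [pi / 2]. *)
have A2 : A * A = - 'i.
  rewrite /A /expi /=; apply/eqP; rewrite eq_complex /=.
  have -> : pi / 4 = (pi / 2) / 2 :> R by field.
  rewrite cosN sinN; set x := pi / 2 / 2.
  have e : pi / 2 = x + x :> R by rewrite /x; field.
  have := cos_pihalf R; have := sin_pihalf R; rewrite e sinD cosD => s c.
  by apply/andP; split; apply/eqP; lra.
have i2 : 'i * 'i = -1 :> R[i] by rewrite -expr2 sqr_i.
have A0 : A != 0.
  apply: contra_eq_neq A2 => ->; rewrite mul0r eq_sym oppr_eq0.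
  by rewrite eq_complex /= negb_and oner_eq0 orbT.
(* Hence ['i] takes the place of [io], and the loop value below is ['i - 'i = 0]. *)
have AV : A^-1 * A^-1 = 'i.
  rewrite -invfM A2; apply: (@mulrI _ (- 'i)); first by rewrite unitfE -A2 mulf_neq0.
  by rewrite mulfV -?A2 ?mulf_neq0 // A2 mulNr i2 opprK.
have loop : - A ^+ 2 - A ^- 2 = 0.
  by rewrite -exprVn !expr2 A2 AV opprK subrr.
(* The chain has [2g + 1] curves, one per generator; [n >= 1] makes [n.-1] a true predecessor. *)
have Nm : (2 * g).+2 = (2 * n)%N by rewrite hg; lia.
have [eta [rho [C [eta_rep eta_sigma rho_rep rho_sigma [injC CE]]]]] :=
  diagram_rep_embedding Nm hl i2 A0 AV loop.
exists eta, rho; split=> //; last exact: equiv_to_subrep_mx CE.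
move=> i j ij; exists (twist_mx R[i] (2 * g).+1 j).
  exact: curve_chain_H1_matrix hS (ht j).
by rewrite rho_sigma ij; exact: ext_mx_is_ext_power.
Qed.
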